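(* Let $f:\mathbb{R}^n\to\mathbb{R}_+$ be differentiable with Lipschitz continuous gradient (with Lipschitz constant $L_f>0$), let $\lambda>0$, and let $\psi:\mathbb{R}_+\to\mathbb{R}_+$ and $\Omega\subseteq\mathbb{R}^n_+$ satisfy Assumption A (see context), with $\phi:=\psi^{-1}$. Consider the problem $$\min_{x\in\mathbb{R}^n}\ F(x):=f(x)+\lambda\sum_{i=1}^n\psi(|x_i|)+\delta_\Omega(|x|).$$ Let $\{x^k\}$ and $\{\bar\eta_k\}$ be generated by the Doubly Majorized Algorithm (DMA) described in the context. Then: (i) $\lim_{k\to\infty}\|x^{k+1}-x^k\|=0$. (ii) The sequences $\{x^k\}$ and $\{\bar\eta_k\}$ are bounded. (iii) Any accumulation point $x^*$ of $\{x^k\}$ satisfies the $\psi_{\rm opt}$-stationarity condition, i.e., there exist $\eta_*>0$ and $\alpha^*\in\{-1,1\}^n$ such that $$x^*\in\operatorname*{Arg\,min}_{|x|\in\Omega}\left\{\frac{\eta_*}{2}\|\psi(|x|)-\psi(|x^*|)\|^2+\sum_{i=1}^n\big[\lambda+\alpha_i^*\cdot\nabla_i f(x^* )\cdot\phi'_+(\psi(|x_i^*|))\big]\cdot\psi(|x_i|)\right\},$$ where $\alpha_i^*=\operatorname{sgn}(x_i^* )$ whenever $x_i^*\neq 0$, and $\alpha_i^*=-\operatorname{sgn}(\nabla_i f(x^* ))$ whenever $x_i^*=0$ and $\nabla_i f(x^* )\neq 0$.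
   Context: Notation: $\mathbb{R}_+=[0,\infty)$. For $x\in\mathbb{R}^n$, $|x|$ is the componentwise absolute value; $\|\cdot\|$ is the Euclidean norm; $\nabla_i f$ is the $i$-th entry of $\nabla f$; for a scalar, $\operatorname{sgn}(t)=1$ if $t\ge 0$ and $\operatorname{sgn}(t)=-1$ if $t<0$, and for a vector $\operatorname{sgn}$ acts componentwise; $\circ$ is the entrywise product; $e$ is the all-ones vector; $[t]_+=\max\{t,0\}$. $\delta_\Omega$ is the indicator function of $\Omega$ ($0$ on $\Omega$, $+\infty$ outside). For $y\in\mathbb{R}^n_+$, $\psi(y)$ and $\phi(y)$ denote the vectors with entries $\psi(y_i)$ and $\phi(y_i)$; $\psi(\Omega):=\{\psi(y):y\in\Omega\}\subseteq\mathbb{R}^n_+$ (a nonempty closed set). For $h:\mathbb{R}_+\to\mathbb{R}$, $h'_+(t):=\lim_{s\downarrow0}\frac{h(t+s)-h(t)}{s}$. $\operatorname{Arg\,min}$ denotes the set of all minimizers; $\operatorname{Arg\,min}_{|x|\in\Omega}$ is over all $x\in\mathbb{R}^n$ with $|x|\in\Omega$. Assumption A: (a) $\psi:\mathbb{R}_+\to\mathbb{R}_+$ satisfies $\psi(0)=0$, is continuous and concave, is differentiable on $(0,\infty)$ with $\psi'>0$ there, and $\lim_{t\to\infty}\psi(t)=\infty$. (b) $\phi:=\psi^{-1}$ exists on $\mathbb{R}_+$, and $\phi'_+$ is (finite and) locally Lipschitz continuous on $\mathbb{R}_+$. (c) $\Omega\subseteq\mathbb{R}^n_+$ is a nonempty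 closed set. Doubly Majorized Algorithm (DMA): Step 0. Take any $x^0\in\mathbb{R}^n$ with $|x^0|\in\Omega$. Let $\gamma_{\max}\ge\gamma_{\min}>0$, $0<\underline{\eta}<\overline{\eta}<\infty$, $c_1>0$, $\tau\in(0,1)$, and let $M\ge0$ be an integer. Let $v^0=\psi(|x^0|)$ and set $k=0$. Step 1. Pick any $\widetilde\gamma\in[\gamma_{\min},\gamma_{\max}]$. Step 1a. Pick any $\widetilde\eta\in[\underline{\eta},\overline{\eta}]$. Let $G_{\widetilde\gamma}(v):=\lambda\langle e,v\rangle+\sum_{i=1}^n g^i_{\widetilde\gamma}(v_i)$ for $v\in\mathbb{R}^n_+$, with $g^i_{\widetilde\gamma}(t):=\frac{1}{2\widetilde\gamma}\big(\phi(t)-|x_i^k-\widetilde\gamma\nabla_i f(x^k)|\big)^2$ for each $i$. Step 1b. Compute (any) $$\widetilde v\in\operatorname*{Arg\,min}_{v\in\psi(\Omega)}\left\{\frac{\widetilde\eta}{2}\|v-v^k\|^2+\sum_{i=1}^n\big[\lambda+(g^i_{\widetilde\gamma})'_+(v_i^k)\big]\cdot(v_i-v_i^k)\right\}.$$ If $G_{\widetilde\gamma}(\widetilde v)\le G_{\widetilde\gamma}(v^k)$, go to Step 1c; otherwise, update $\widetilde\eta\leftarrow\widetilde\eta/\tau$ and go to Step 1b. Step 1c. Set $\widetilde u=\operatorname{sgn}(x^k-\widetilde\gamma\nabla f(x^k))\circ\phi(\widetilde v)$. If $$F(\widetilde u)\le\max_{[k-M]_+\le i\le k}F(x^i)-\frac{c_1}{2}\|\widetilde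 u-x^k\|^2,$$ go to Step 2; otherwise, update $\widetilde\gamma\leftarrow\tau\widetilde\gamma$ and go to Step 1a. Step 2. Set $\bar\eta_k=\widetilde\eta$, $\gamma_k=\widetilde\gamma$, $v^{k+1}=\widetilde v$ and $x^{k+1}=\widetilde u$. Update $k\leftarrow k+1$ and go to Step 1. (The loops in Steps 1b and 1c terminate after finitely many repetitions in each iteration, so the algorithm generates infinite sequences, and $v^k=\psi(|x^k|)$ for all $k$.) *)

(* Defs.v *)
From HB Require Import structures.
From mathcomp Require Import all_boot all_order all_algebra.
From mathcomp Require Import all_classical all_reals all_analysis.

Set Implicit Arguments.
Unset Strict Implicit.
Unset Printing Implicit Defensive.
Import Order.TTheory GRing.Theory Num.Theory.
Import numFieldNormedType.Exports.
Local Open Scope classical_set_scope.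
Local Open Scope ring_scope.

(* The norm that the library puts on 'rV[R]_n is the sup norm (with the usual
   topology); the Euclidean norm is defined here. *)
Definition enorm (R : realType) (n : nat) (x : 'rV[R]_n) : R :=
  Num.sqrt (\sum_(i < n) x 0 i ^+ 2).

Definition absv (R : realType) (n : nat) (x : 'rV[R]_n) : 'rV[R]_n :=
  map_mx (fun t => `|t|) x.

(* Unlike Num.sg, this sign takes the value 1 at 0. *)
Definition sgn1 (R : realType) (t : R) : R := if 0 <= t then 1 else -1.

Definition grad (R : realType) (n : nat) (f : 'rV[R]_n -> R) (x : 'rV[R]_n) :
  'rV[R]_n := \row_(i < n) 'D_('e_i) f x.

Definition rquot (R : realType) (h : R -> R) (t s : R) : R :=
  (h (t + s) - h t) / s.

Definition rderiv (R : realType) (h : R -> R) (t : R) : R :=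
  lim (rquot h t s @[s --> 0^'+]).

Definition argmin (R : realType) (T : Type) (A : set T) (h : T -> R) : set T :=
  [set x | A x /\ forall y, A y -> h x <= h y].

(* Functions on [0, +oo[ are represented by functions on R of which only the
   values on [0, +oo[ are constrained or used. *)
Record assumptionA (R : realType) (n : nat) (psi phi : R -> R)
    (Omega : set 'rV[R]_n) : Prop := AssumptionA {
  A_psi_ge0 : forall t : R, 0 <= t -> 0 <= psi t;
  A_psi0 : psi 0 = 0;
  A_psi_continuous : {within `[0, +oo[, continuous psi};
  A_psi_concave : @convex_function R R^o `[0, +oo[ (fun t => - psi t);
  A_psi_derivable : forall t : R, 0 < t -> derivable psi t 1;
  A_psi_derive_gt0 : forall t : R, 0 < t -> 0 < derive1 psi t;
  A_psi_pinfty : psi t @[t --> +oo] --> +oo;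
  A_phi_ge0 : forall t : R, 0 <= t -> 0 <= phi t;
  A_psiK : forall t : R, 0 <= t -> phi (psi t) = t;
  A_phiK : forall t : R, 0 <= t -> psi (phi t) = t;
  A_phi_rderivable : forall t : R, 0 <= t -> cvg (rquot phi t s @[s --> 0^'+]);
  A_phi_rderiv_lipschitz :
    [locally [lipschitz rderiv phi t | t in `[0, +oo[%classic]];
  A_Omega_ge0 : forall y, Omega y -> forall i, 0 <= y 0 i;
  A_Omega_neq0 : Omega !=set0;
  A_Omega_closed : closed Omega
}.

Section Problem.
Context {R : realType} {n : nat}.
Variables (f : 'rV[R]_n -> R) (psi phi : R -> R) (Omega : set 'rV[R]_n).
Variable lambda : R.
Implicit Types (x xk u v vk : 'rV[R]_n) (gamma eta : R).

Definition delta (A : set 'rV[R]_n) (y : 'rV[R]_n) : \bar R :=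
  if y \in A then 0%E else +oo%E.

Definition objective x : \bar R :=
  ((f x + lambda * \sum_(i < n) psi `|x 0 i|)%:E + delta Omega (absv x))%E.

Definition gfun gamma x (i : 'I_n) (t : R) : R :=
  (2 * gamma)^-1 * (phi t - `|x 0 i - gamma * grad f x 0 i|) ^+ 2.

Definition Gfun gamma x v : R :=
  lambda * (\sum_(i < n) v 0 i) + \sum_(i < n) gfun gamma x i (v 0 i).

Definition surrogate gamma eta xk vk v : R :=
  eta / 2 * enorm (v - vk) ^+ 2 +
  \sum_(i < n) (lambda + rderiv (gfun gamma xk i) (vk 0 i)) * (v 0 i - vk 0 i).

Definition candidate gamma xk v : 'rV[R]_n :=
  \row_(i < n) (sgn1 (xk 0 i - gamma * grad f xk 0 i) * phi (v 0 i)).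

Definition psi_opt_stationary (xs : 'rV[R]_n) : Prop :=
  exists (eta : R) (alpha : 'rV[R]_n),
    [/\ 0 < eta,
        forall i, alpha 0 i = 1 \/ alpha 0 i = -1,
        argmin [set x | Omega (absv x)]
          (fun x => eta / 2 *
               enorm (map_mx psi (absv x) - map_mx psi (absv xs)) ^+ 2 +
             \sum_(i < n) (lambda + alpha 0 i * grad f xs 0 i *
                                      rderiv phi (psi `|xs 0 i|)) *
                          psi `|x 0 i|) xs,
        forall i, xs 0 i != 0 -> alpha 0 i = sgn1 (xs 0 i) &
        forall i, xs 0 i = 0 -> grad f xs 0 i != 0 ->
          alpha 0 i = - sgn1 (grad f xs 0 i)].

Section Algorithm.
Variables (gmin gmax etamin etamax c1 tau : R) (M : nat).

(* [eta_loop xk vk gamma eta eta' v']: entering Step 1b with current value eta,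
   the loop can be left with final value eta' and vector v'. *)
Inductive eta_loop xk vk gamma : R -> R -> 'rV[R]_n -> Prop :=
| EtaAccept eta v of
    argmin (map_mx psi @` Omega) (surrogate gamma eta xk vk) v &
    Gfun gamma xk v <= Gfun gamma xk vk :
    eta_loop xk vk gamma eta eta v
| EtaReject eta v eta' v' of
    argmin (map_mx psi @` Omega) (surrogate gamma eta xk vk) v &
    Gfun gamma xk vk < Gfun gamma xk v &
    eta_loop xk vk gamma (eta / tau) eta' v' :
    eta_loop xk vk gamma eta eta' v'.

Definition line_search_test (Fmax : \bar R) xk u : Prop :=
  (objective u <= Fmax - (c1 / 2 * enorm (u - xk) ^+ 2)%:E)%E.

(* [gamma_loop xk vk Fmax gamma gamma' eta' v' u']: entering Step 1a with
   current value gamma, the loop can be left towards Step 2 with these final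
   values. *)
Inductive gamma_loop xk vk (Fmax : \bar R) :
    R -> R -> R -> 'rV[R]_n -> 'rV[R]_n -> Prop :=
| GammaAccept gamma eta0 eta v of
    etamin <= eta0 <= etamax &
    eta_loop xk vk gamma eta0 eta v &
    line_search_test Fmax xk (candidate gamma xk v) :
    gamma_loop xk vk Fmax gamma gamma eta v (candidate gamma xk v)
| GammaReject gamma eta0 eta v gamma' eta' v' u' of
    etamin <= eta0 <= etamax &
    eta_loop xk vk gamma eta0 eta v &
    ~ line_search_test Fmax xk (candidate gamma xk v) &
    gamma_loop xk vk Fmax (tau * gamma) gamma' eta' v' u' :
    gamma_loop xk vk Fmax gamma gamma' eta' v' u'.

Record generated_by_DMA (x v : nat -> 'rV[R]_n) (gamma_ etabar : nat -> R) :
    Prop := GeneratedByDMA {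
  DMA_x0 : Omega (absv (x 0%N));
  DMA_v0 : v 0%N = map_mx psi (absv (x 0%N));
  DMA_step : forall k, exists2 gamma0, gmin <= gamma0 <= gmax &
    gamma_loop (x k) (v k)
      (\big[maxe/-oo%E]_((k - M)%N <= i < k.+1) objective (x i))
      gamma0 (gamma_ k) (etabar k) (v k.+1) (x k.+1)
}.

End Algorithm.
End Problem.

(* Main.v *)
Require Import Defs.
From mathcomp Require Import all_boot all_order all_algebra.
From mathcomp Require Import all_classical all_reals all_analysis.
From mathcomp Require Import ring lra.

Import Order.TTheory GRing.Theory Num.Theory.
Import numFieldNormedType.Exports.
Local Open Scope classical_set_scope.
Local Open Scope ring_scope.

(* Since phi = psi^-1 is convex with right derivative p, p(s) (t - s) <= phi(t) -
   phi(s) <= p(t) (t - s); with p locally Lipschitz this bounds each g^i above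
   by its linearization plus a quadratic, so on bounded sets the test of Step 1b
   succeeds for all large eta. A point passing that test satisfies the test of
   Step 1c as soon as gamma (Lf + c1) <= 1, hence gamma_k is bounded below and
   etabar_k above. The objective is bounded by its initial value, so the iterates
   are bounded, and the Grippo-Lampariello-Lucidi argument applied to the maxima
   over windows of length M + 1 gives (i). For (iii), etabar_k may be replaced by
   its upper bound in the optimality of v^{k+1} because v^{k+1} - v^k -> 0, so
   neither etabar_k nor gamma_k has to converge along the subsequence. *)

(** * Scalar analysis of [psi], its inverse [phi] and the right derivative of [phi] *)

Section ScalarFunctions.
Context {R : realType} {n : nat}.
Variables (psi phi : R -> R) (Omega : set 'rV[R]_n).
Hypothesis HA : assumptionA psi phi Omega.

Lemma psi_lt (a b : R) : 0 <= a -> a < b -> psi a < psi b.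
Proof.
move=> a0 ab.
have sub0 : `[0, b] `<=` `[0, +oo[.
  by move=> z /=; rewrite !in_itv/= andbT => /andP[].
apply: (@gtr0_derive1_lt_cc R psi 0 b) => //.
- by move=> z; rewrite in_itv/= => /andP[z0 _]; exact: (A_psi_derivable HA).
- by move=> z; rewrite in_itv/= => /andP[z0 _]; exact: (A_psi_derive_gt0 HA).
- exact: continuous_subspaceW sub0 (A_psi_continuous HA).
- by rewrite in_itv/= a0 ltW.
- by rewrite in_itv/= lexx andbT (le_trans a0 (ltW ab)).
Qed.

Lemma psi_le (a b : R) : 0 <= a -> a <= b -> psi a <= psi b.
Proof.
move=> a0; rewrite le_eqVlt => /orP[/eqP -> //|ab].
exact/ltW/psi_lt.
Qed.

Lemma phi_le (s t : R) : 0 <= s -> s <= t -> phi s <= phi t.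
Proof.
move=> s0 st; rewrite leNgt; apply/negP => ts.
have t0 := le_trans s0 st.
have := psi_lt _ _ (A_phi_ge0 HA t0) ts.
by rewrite !(A_phiK HA)// ltNge st.
Qed.

Lemma phi_gt0 (t : R) : 0 < t -> 0 < phi t.
Proof.
move=> t0; rewrite lt_neqAle (A_phi_ge0 HA (ltW t0)) andbT.
apply/eqP => /(congr1 psi); rewrite (A_phiK HA (ltW t0)) (A_psi0 HA) => e.
by rewrite -e ltxx in t0.
Qed.

Lemma psi_concaveE (t a b : R) : 0 <= t <= 1 -> 0 <= a -> 0 <= b ->
  t * psi a + (1 - t) * psi b <= psi (t * a + (1 - t) * b).
Proof.
move=> /andP[t0 t1] a0 b0.
have t01 : Itv.spec (@Itv.num_sem R) (Itv.Real `[0%Z, 1%Z]) t.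
  by apply/andP; split; [exact: ger0_real | rewrite in_itv/= t0 t1].
have Ia : a \in (`[0, +oo[%classic : set R) by rewrite inE/= in_itv/= a0.
have Ib : b \in (`[0, +oo[%classic : set R) by rewrite inE/= in_itv/= b0.
have H : - psi (t * a + (1 - t) * b) <= t * - psi a + (1 - t) * - psi b.
  exact: (A_psi_concave HA (Itv.mk t01) Ia Ib).
lra.
Qed.

(** Both a and b are convex combinations of a + b and 0, with complementary weights; since
    [psi 0 = 0], adding the two concavity inequalities gives the claim. *)
Lemma psi_subadditive (a b : R) : 0 <= a -> 0 <= b ->
  psi (a + b) <= psi a + psi b.
Proof.
move=> a0 b0; have [/eqP|ab0] := eqVneq (a + b) 0.
  by rewrite paddr_eq0// => /andP[/eqP-> /eqP->]; rewrite addr0 (A_psi0 HA) addr0.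
have abp : 0 < a + b by rewrite lt_neqAle eq_sym ab0 addr_ge0.
pose t := a / (a + b).
have t01 : 0 <= t <= 1.
  by rewrite divr_ge0 ?(ltW abp)//= ler_pdivrMr// mul1r lerDl.
have t01' : 0 <= 1 - t <= 1 by lra.
have := psi_concaveE t (a + b) 0 t01 (ltW abp) (lexx 0).
have := psi_concaveE (1 - t) (a + b) 0 t01' (ltW abp) (lexx 0).
have -> : t * (a + b) + (1 - t) * 0 = a by rewrite /t; field.
have -> : (1 - t) * (a + b) + (1 - (1 - t)) * 0 = b by rewrite /t; field.
by rewrite (A_psi0 HA); lra.
Qed.

(** Subadditivity makes [psi] its own modulus of continuity. This takes the place of a Lipschitz
    bound, which can fail at 0, as for the square root. *)
Lemma psi_dist (a b : R) : 0 <= a -> 0 <= b ->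
  `|psi a - psi b| <= psi `|a - b|.
Proof.
wlog ba : a b / b <= a.
  move=> H a0 b0; case: (leP b a) => [ba|/ltW ab]; first exact: H.
  by rewrite distrC (distrC a); exact: H.
move=> a0 b0; rewrite !ger0_norm ?subr_ge0//; last exact: psi_le.
rewrite lerBlDr -{1}(subrK b a); apply: psi_subadditive => //.
by rewrite subr_ge0.
Qed.

Lemma phi_convexE (t a b : R) : 0 <= t <= 1 -> 0 <= a -> 0 <= b ->
  phi (t * a + (1 - t) * b) <= t * phi a + (1 - t) * phi b.
Proof.
move=> t01 a0 b0.
have := psi_concaveE t _ _ t01 (A_phi_ge0 HA a0) (A_phi_ge0 HA b0).
rewrite !(A_phiK HA)// => le1.
have /andP[t0 t1] := t01.
have z0 : 0 <= t * a + (1 - t) * b by rewrite addr_ge0// mulr_ge0// subr_ge0.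
have w0 : 0 <= t * phi a + (1 - t) * phi b.
  by rewrite addr_ge0// mulr_ge0 ?subr_ge0//; exact: (A_phi_ge0 HA).
by have := phi_le _ _ z0 le1; rewrite (A_psiK HA).
Qed.

Local Notation p := (rderiv phi).

Lemma cvg_rquot_phi (s : R) : 0 <= s -> rquot phi s h @[h --> 0^'+] --> p s.
Proof. by move=> s0; exact: (A_phi_rderivable HA). Qed.

(** By convexity, the forward difference quotients at s lie above the chord slopes from points on
    the left and, for small increments, below those to points on the right. Both bounds survive the
    limit that defines [rderiv]. *)
Lemma phi_subgradient (s t : R) : 0 <= s -> 0 <= t ->
  p s * (t - s) <= phi t - phi s.
Proof.
move=> s0 t0; case: (ltrgtP t s) => [ts|st|->]; last by rewrite !subrr mulr0.
- have st0 : 0 < s - t by rewrite subr_gt0.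
  suff H : (phi s - phi t) / (s - t) <= p s.
    by rewrite ler_pdivrMr// in H; lra.
  apply: (limr_ge (A_phi_rderivable HA s0)).
  near=> h.
  have h0 : 0 < h by [].
  rewrite /rquot ler_pdivrMr// mulrAC ler_pdivlMr//.
  have hs : 0 < h + (s - t) by rewrite addr_gt0.
  have u01 : 0 <= h / (h + (s - t)) <= 1.
    by rewrite divr_ge0 ?(ltW hs) ?(ltW h0)//= ler_pdivrMr// mul1r lerDl ltW.
  have := phi_convexE _ t (s + h) u01 t0 (addr_ge0 s0 (ltW h0)).
  have -> : h / (h + (s - t)) * t + (1 - h / (h + (s - t))) * (s + h) = s.
    by field; rewrite gt_eqF.
  have -> : h / (h + (s - t)) * phi t + (1 - h / (h + (s - t))) * phi (s + h)
     = (h * phi t + (s - t) * phi (s + h)) / (h + (s - t)).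
    by field; rewrite gt_eqF.
  by rewrite ler_pdivlMr//; lra.
- have ts0 : 0 < t - s by rewrite subr_gt0.
  rewrite -ler_pdivlMr//.
  apply: (limr_le (A_phi_rderivable HA s0)).
  near=> h.
  have h0 : 0 < h by [].
  have ht : h < t - s by near: h; exact: nbhs_right_lt.
  rewrite /rquot ler_pdivrMr// mulrAC ler_pdivlMr//.
  have u01 : 0 <= h / (t - s) <= 1.
    by rewrite divr_ge0 ?(ltW ts0) ?(ltW h0)//= ler_pdivrMr// mul1r ltW.
  have := phi_convexE _ t s u01 t0 s0.
  have -> : h / (t - s) * t + (1 - h / (t - s)) * s = s + h.
    by field; rewrite gt_eqF.
  have -> : h / (t - s) * phi t + (1 - h / (t - s)) * phi s
     = (h * phi t + (t - s - h) * phi s) / (t - s).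
    by field; rewrite gt_eqF.
  by rewrite ler_pdivlMr//; lra.
Unshelve. all: by end_near. Qed.

Lemma phi_rderiv_le (s t : R) : 0 <= s -> s <= t -> p s <= p t.
Proof.
move=> s0 st; have t0 := le_trans s0 st.
have := phi_subgradient s t s0 t0; have := phi_subgradient t s t0 s0.
move: st; rewrite le_eqVlt => /orP[/eqP -> //|st].
rewrite -subr_gt0 in st; move=> ? ?; rewrite -(ler_pM2r st); lra.
Qed.

Lemma phi_rderiv_bound (B s : R) : 0 <= s <= B -> `|p s| <= `|p 0| + `|p B|.
Proof.
move=> /andP[s0 sB].
have := phi_rderiv_le 0 s (lexx 0) s0; have := phi_rderiv_le s B s0 sB.
have := ler_norm (p B); have := ler_norm (- p 0); rewrite normrN.
have := normr_ge0 (p B); have := normr_ge0 (p 0).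
by rewrite ler_norml; lra.
Qed.

Lemma phi_lipschitz (B s t : R) : 0 <= s <= B -> 0 <= t <= B ->
  `|phi t - phi s| <= (`|p 0| + `|p B|) * `|t - s|.
Proof.
wlog st : s t / s <= t.
  move=> H sB tB; case: (leP s t) => [st|/ltW ts]; first exact: H.
  by rewrite distrC (distrC t); exact: H.
move=> sB tB; have /andP[s0 _] := sB; have /andP[t0 _] := tB.
rewrite (@ger0_norm _ (t - s)) ?subr_ge0// ger0_norm ?subr_ge0; last exact: phi_le.
have := phi_subgradient t s t0 s0.
have ts0 : 0 <= t - s by rewrite subr_ge0.
have := ler_wpM2r ts0 (le_trans (ler_norm _) (phi_rderiv_bound B t tB)).
lra.
Qed.

(** Compactness of [0, B] yields one C for which the estimate holds for all pairs closer than 1/C;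
    for distant pairs the boundedness of [p] is enough. *)
Lemma phi_rderiv_lipschitz (B : R) : 0 <= B ->
  exists2 C, 0 <= C & forall s t, 0 <= s <= B -> 0 <= t <= B ->
    `|p s - p t| <= C * `|s - t|.
Proof.
move=> B0.
have cK : compact `[0%R, B] by exact: segment_compact.
have /compact_near_coveringP/(_ R (pinfty_nbhs R)
  (fun C s => 0 < C /\ forall t, 0 <= s -> 0 <= t -> `|s - t| < C^-1 ->
     `|p s - p t| <= C * `|s - t|)) := cK.
move=> /(_ _) nc.
have {}nc : \forall C \near +oo, forall s, s \in `[0, B] ->
    0 < C /\ forall t, 0 <= s -> 0 <= t -> `|s - t| < C^-1 ->
     `|p s - p t| <= C * `|s - t|.
  apply: nc => s0; rewrite /= in_itv/= => /andP[s00 _].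
  have s0in : (`[0, +oo[ `*` `[0, +oo[) (s0, s0).
    by split; rewrite /= in_itv/= andbT.
  have [C0 [_ HC0]] := @A_phi_rderiv_lipschitz _ _ _ _ _ HA (s0, s0) s0in.
  have [C1 C10 C01] : exists2 C1, 0 < C1 & C0 < C1.
    by exists (`|C0| + 1); have := ler_norm C0; have := normr_ge0 C0; lra.
  have /nbhs_ballP[e /= e0 He] := HC0 _ C01.
  (* With C > 2/e, a point t within 1/C of s is within e/2 of it, so both s and t lie in the ball of
     radius e about s0 where the local estimate holds. *)
  exists (ball s0 (e / 2), [set C | Num.max C1 (2 / e) < C]) => /=.
    split; first by apply: nbhsx_ballx; rewrite divr_gt0.
    by apply: nbhs_pinfty_gt; exact: num_real.
  move=> [s C] /= [s0s]; rewrite gt_max => /andP[C1C eC].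
  have C_gt0 : 0 < C := lt_trans C10 C1C.
  split => // t s_ge0 t_ge0 st.
  have eC' : C^-1 < e / 2.
    by rewrite -[ltRHS]invrK ltf_pV2 ?posrE ?invr_gt0 ?divr_gt0// invf_div.
  rewrite /ball/= in s0s.
  have s0t : `|s0 - t| < e.
    have -> : s0 - t = (s0 - s) + (s - t) by ring.
    by apply: (le_lt_trans (ler_normD _ _)); lra.
  have := He (s, t); rewrite /ball /= /prod_ball /= /ball /=.
  have s0s' : `|s0 - s| < e by lra.
  move=> /(_ (conj s0s' s0t)) /=; rewrite !in_itv/= !andbT.
  move=> /(_ (conj s_ge0 t_ge0)) /le_trans; apply.
  by rewrite ler_wpM2r// ltW.
have [C [C0 HC]] : exists C, 0 < C /\ forall s t, 0 <= s <= B -> 0 <= t <= B ->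
    `|s - t| < C^-1 -> `|p s - p t| <= C * `|s - t|.
  near (pinfty_nbhs R) => C.
  have HC : forall s, s \in `[0, B] ->
    0 < C /\ forall t, 0 <= s -> 0 <= t -> `|s - t| < C^-1 ->
     `|p s - p t| <= C * `|s - t| by near: C.
  exists C; split.
    by have [] := HC 0; rewrite //= in_itv/= lexx B0.
  move=> s t sB /andP[t0 tB] st; have [|_] := HC s; first by rewrite in_itv.
  by apply => //; case/andP: sB.
pose P := `|p 0| + `|p B|.
have P0 : 0 <= P by rewrite addr_ge0.
(* The term C serves the close pairs. For the others 1 <= C |s - t|, so the crude bound 2 P is at
   most 2 P C |s - t|. *)
exists (C + 2 * P * C); first by rewrite addr_ge0 ?mulr_ge0// ltW.
move=> s t sB tB; have [st|st] := ltP `|s - t| C^-1.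
  apply: le_trans (HC _ _ sB tB st) _.
  by rewrite ler_wpM2r// lerDl !mulr_ge0// ltW.
have := phi_rderiv_bound _ _ sB; have := phi_rderiv_bound _ _ tB.
rewrite -/P => bt bs; apply: le_trans (ler_normB _ _) _.
apply: (@le_trans _ _ (2 * P)); first by lra.
have : 1 <= C * `|s - t| by rewrite mulrC -ler_pdivrMr// div1r.
move=> H1; have := normr_ge0 (s - t); nra.
Unshelve. all: by end_near. Qed.

(** The subgradient inequalities at s and at t squeeze the remainder between 0 and (p t - p s) (t -
    s), which the Lipschitz bound on [p] makes quadratic. *)
Lemma phi_taylor (B : R) : 0 <= B ->
  exists2 C, 0 <= C & forall s t, 0 <= s <= B -> 0 <= t <= B ->
    `|phi t - phi s - p s * (t - s)| <= C * (t - s) ^+ 2.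
Proof.
move=> /phi_rderiv_lipschitz[C C0 HC]; exists C => // s t sB tB.
have /andP[s0 _] := sB; have /andP[t0 _] := tB.
have := phi_subgradient s t s0 t0; have := phi_subgradient t s t0 s0.
move=> H1 H2; rewrite ger0_norm; last by lra.
apply: (@le_trans _ _ ((p t - p s) * (t - s))); first by lra.
apply: le_trans (ler_norm _) _; rewrite normrM.
apply: le_trans (ler_wpM2r (normr_ge0 _) (HC _ _ tB sB)) _.
by rewrite -mulrA -expr2 real_normK// num_real.
Qed.

Lemma rderiv_half_sqr (a c s : R) : 0 <= s ->
  rderiv (fun t => a * (phi t - c) ^+ 2) s = 2 * a * (phi s - c) * p s.
Proof.
move=> s0; rewrite /rderiv.
(* Right continuity follows from the convergence of the difference quotient multiplied by h. *)
have cphi : phi (s + h) @[h --> 0^'+] --> phi s.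
  have H : (phi s + h * rquot phi s h) @[h --> 0^'+] --> phi s + 0 * p s.
    apply: cvgD; first exact: cvg_cst.
    apply: cvgM; last exact: cvg_rquot_phi.
    exact: cvg_at_right_filter.
  rewrite mul0r addr0 in H; apply: cvg_trans H.
  apply: near_eq_cvg; near=> h.
  have h0 : 0 < h by [].
  by rewrite /rquot; field; rewrite gt_eqF.
apply: cvg_lim => //.
have -> : 2 * a * (phi s - c) * p s = a * (p s * (phi s - c + (phi s - c))).
  by ring.
have : (a * (rquot phi s h * (phi (s + h) - c + (phi s - c)))) @[h --> 0^'+] -->
   a * (p s * (phi s - c + (phi s - c))).
  apply: cvgM; first exact: cvg_cst.
  apply: cvgM; first exact: cvg_rquot_phi.
  apply: cvgD; last exact: cvg_cst.
  by apply: cvgB; [exact: cphi | exact: cvg_cst].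
move=> H; apply: cvg_trans H; apply: near_eq_cvg; near=> h.
have h0 : 0 < h by [].
by rewrite /rquot; field; rewrite gt_eqF.
Unshelve. all: by end_near. Qed.

(** A quadratic majorant of g^i, uniform in the step size and in the target c. Expanding the square
    about [phi s] leaves two errors: the squared increment of [phi], bounded by P^2 (t - s)^2, and
    the Taylor remainder weighted by 2 (phi s - c). *)
Lemma half_sqr_majorant (B A gl : R) : 0 <= B -> 0 <= A -> 0 < gl ->
  exists2 K, 0 < K & forall g c s t, gl <= g -> 0 <= c <= A ->
    0 <= s <= B -> 0 <= t <= B ->
    (2 * g)^-1 * (phi t - c) ^+ 2 <= (2 * g)^-1 * (phi s - c) ^+ 2 +
      rderiv (fun t => (2 * g)^-1 * (phi t - c) ^+ 2) s * (t - s) +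
      K / 2 * (t - s) ^+ 2.
Proof.
move=> B0 A0 gl0; have [C C0 HC] := phi_taylor B B0.
pose P := `|p 0| + `|p B|.
have P0 : 0 <= P by rewrite addr_ge0.
pose K := P ^+ 2 + 2 * (phi B + A) * C.
have phiB0 := A_phi_ge0 HA B0.
have K0 : 0 <= K by rewrite addr_ge0 ?sqr_ge0// !mulr_ge0// addr_ge0.
(* The added 1 makes the constant strictly positive. *)
exists ((K + 1) / gl); first by rewrite divr_gt0// ltr_wpDl.
move=> g c s t glg /andP[c0 cA] sB tB.
have /andP[s0 sB'] := sB; have g0 : 0 < g := lt_le_trans gl0 glg.
rewrite rderiv_half_sqr//.
set d2 := (t - s) ^+ 2; have d20 : 0 <= d2 by exact: sqr_ge0.
suff H : (phi t - c) ^+ 2 <= (phi s - c) ^+ 2 + 2 * (phi s - c) * p s * (t - s)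
    + K * d2.
  have -> : 2 * (2 * g)^-1 * (phi s - c) * p s * (t - s) =
     (2 * g)^-1 * (2 * (phi s - c) * p s * (t - s)) by ring.
  rewrite -mulrDr.
  have le1 : (2 * g)^-1 * (K * d2) <= (K + 1) / gl / 2 * d2.
    have -> : (K + 1) / gl / 2 * d2 = ((K + 1) * d2 / 2) * gl^-1 by ring.
    have -> : (2 * g)^-1 * (K * d2) = (K * d2 / 2) * g^-1 by rewrite invfM; ring.
    have Kd : K * d2 / 2 <= (K + 1) * d2 / 2 by nra.
    have Kd0 : 0 <= K * d2 / 2 by apply: divr_ge0 => //; exact: mulr_ge0.
    by apply: ler_pM => //; [rewrite invr_ge0 ltW | rewrite lef_pV2].
  have ge2 : 0 <= (2 * g)^-1 by rewrite invr_ge0 mulr_ge0// ltW.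
  by have := ler_wpM2l ge2 H; lra.
have := HC s t sB tB; have := phi_lipschitz B s t sB tB.
rewrite -/P -/d2 => H1 H2.
have H3 : (phi t - phi s) ^+ 2 <= P ^+ 2 * d2.
  by rewrite /d2 -exprMn -real_normK ?num_real// -[leRHS]real_normK ?num_real//
    lerXn2r ?nnegrE// normrM (ger0_norm P0).
set e := phi t - phi s - p s * (t - s) in H2.
have phis0 := A_phi_ge0 HA s0; have phisB := phi_le s B s0 sB'.
have H4 : (phi s - c) * e <= (phi B + A) * (C * d2).
  apply: le_trans (ler_norm _) _; rewrite normrM.
  apply: ler_pM => //.
  by rewrite ler_norml; lra.
have -> : (phi t - c) ^+ 2 = (phi t - phi s) ^+ 2 + 2 * ((phi s - c) * e)
  + (phi s - c) ^+ 2 + 2 * (phi s - c) * p s * (t - s) by rewrite /e; ring.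
by rewrite /K; lra.
Qed.

End ScalarFunctions.

(** * The Euclidean norm and the descent lemma for Lipschitz gradients *)

Section Euclidean.
Context {R : realType} {n : nat}.
Implicit Types x y d : 'rV[R]_n.

Lemma enorm_ge0 x : 0 <= enorm x.
Proof. exact: sqrtr_ge0. Qed.

Lemma enorm_sqr x : enorm x ^+ 2 = \sum_(i < n) x 0 i ^+ 2.
Proof. by rewrite sqr_sqrtr// sumr_ge0// => i _; exact: sqr_ge0. Qed.

Lemma coord_le_enorm x i : `|x 0 i| <= enorm x.
Proof.
rewrite -sqrtr_sqr ler_wsqrtr// (bigD1 i)//= lerDl.
by rewrite sumr_ge0// => j _; exact: sqr_ge0.
Qed.

Lemma enorm_le_sum x : enorm x <= \sum_(i < n) `|x 0 i|.
Proof.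
have S0 : 0 <= \sum_(i < n) `|x 0 i| by rewrite sumr_ge0.
rewrite -(ger0_norm S0) -sqrtr_sqr ler_wsqrtr// expr2 mulr_suml.
apply: ler_sum => i _; rewrite -real_normK ?num_real// expr2 ler_wpM2l//.
by rewrite (bigD1 i)//= lerDl sumr_ge0.
Qed.

Lemma derive_grad (f : 'rV[R]_n -> R) x d : differentiable f x ->
  'D_d f x = \sum_(i < n) grad f x 0 i * d 0 i.
Proof.
move=> df; rewrite deriveE// {1}(row_sum_delta d) linear_sum.
apply: eq_bigr => i _; rewrite linearZ/= /grad mxE deriveE//.
exact: mulrC.
Qed.

Lemma is_derive_line (f : 'rV[R]_n -> R) x d (t : R) :
  differentiable f (x + t *: d) ->
  is_derive t 1 (fun s : R => f (x + s *: d)) ('D_d f (x + t *: d)).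
Proof.
move=> df.
have E : (fun h : R => h^-1 *: (f (x + (h *: 1 + t) *: d) - f (x + t *: d))) =
         (fun h : R => h^-1 *: (f (h *: d + (x + t *: d)) - f (x + t *: d))).
  apply/funext => h; congr (_ *: (f _ - _)).
  by rewrite [h *: 1]mulr1 scalerDl addrCA.
split; first by rewrite /derivable E; exact: diff_derivable.
by rewrite /derive E.
Qed.

(** The mean value theorem on [0, 1] is applied to [k], the restriction of f to the segment minus
    its linear part and t^2 L/2 |d|^2; its derivative is nonpositive by the Lipschitz bound. *)
Lemma grad_lipschitz_descent (f : 'rV[R]_n -> R) (L : R) x y :
  (forall z, differentiable f z) -> 0 < L ->
  (forall z w, enorm (grad f z - grad f w) <= L * enorm (z - w)) ->
  f y <= f x + \sum_(i < n) grad f x 0 i * (y 0 i - x 0 i)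
           + L / 2 * enorm (y - x) ^+ 2.
Proof.
move=> df L0 Lip; set d := y - x; set D := enorm d ^+ 2.
pose G (z : 'rV[R]_n) := \sum_(i < n) grad f z 0 i * d 0 i.
pose k (t : R) := f (x + t *: d) - t * G x - t ^+ 2 * (L / 2 * D).
pose dk (t : R) := G (x + t *: d) - G x - t * (L * D).
have dkE (t : R) : is_derive t 1 k (dk t).
  have H := @is_derive_line f x d t (df _).
  rewrite derive_grad// -/(G _) in H.
  rewrite /k /dk; apply: is_derive_eq.
  by rewrite /GRing.scale/=; field.
have [|c c01] := @MVT R k dk 0 1 ltr01 (fun t _ => dkE t).
  apply: derivable_within_continuous => t _.
  exact: ex_derive.
move: c01; rewrite in_itv/= => /andP[c0 c1].
have dk0 : dk c <= 0.
  rewrite /dk /G -sumrB subr_le0.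
  (* The weight L c is the one for which both halves are at most L c D / 2 once the gradient
     increment is bounded by L c |d|. *)
  apply: (@le_trans _ _ (\sum_(i < n) ((2 * (L * c))^-1 *
    (grad f (x + c *: d) - grad f x) 0 i ^+ 2 + L * c / 2 * d 0 i ^+ 2))).
    apply: ler_sum => i _; rewrite !mxE -mulrBl.
    set a := (X in X * _ <= _); set b := (X in _ * X <= _).
    have Lc : 0 < L * c by rewrite mulr_gt0.
    (* Young's inequality [a b <= a^2 / (2 L c) + L c b^2 / 2] *)
    rewrite -subr_ge0.
    have -> : (2 * (L * c))^-1 * a ^+ 2 + L * c / 2 * b ^+ 2 - a * b =
      (2 * (L * c))^-1 * (a - L * c * b) ^+ 2.
      by field; rewrite !gt_eqF.
    by rewrite mulr_ge0 ?sqr_ge0// invr_ge0 mulr_ge0// ltW.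
  rewrite big_split/= -!mulr_sumr -!enorm_sqr -/D.
  have := Lip (x + c *: d) x; rewrite addrAC subrr add0r.
  have -> : enorm (c *: d) = c * enorm d.
    apply/eqP; rewrite -(@eqrXn2 _ 2)// ?mulr_ge0 ?enorm_ge0 ?(ltW c0)//.
    rewrite exprMn !enorm_sqr mulr_sumr; apply/eqP/eq_bigr => i _.
    by rewrite mxE exprMn.
  move=> H; have {}H : enorm (grad f (x + c *: d) - grad f x) ^+ 2 <=
      (L * c) ^+ 2 * D.
    rewrite /D -exprMn lerXn2r ?nnegrE ?enorm_ge0// -?mulrA//.
    by rewrite !mulr_ge0 ?enorm_ge0// ltW.
  have Lc : 0 < L * c by rewrite mulr_gt0.
  have Lc2 : 0 <= (2 * (L * c))^-1 by rewrite invr_ge0 mulr_ge0// ltW.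
  apply: le_trans (lerD (ler_wpM2l Lc2 H) (lexx _)) _.
  by rewrite le_eqVlt; apply/orP; left; apply/eqP; field; rewrite !gt_eqF.
rewrite /k scale0r scale1r addr0 [x + d]addrC subrK subr0 mulr1.
have -> : \sum_(i < n) grad f x 0 i * (y 0 i - x 0 i) = G x.
  by apply: eq_bigr => i _; rewrite !mxE.
by move=> H; lra.
Qed.

End Euclidean.

(** Stated for any total order, so that it serves both windows of nonnegative reals with default 0
    and windows of extended reals with default [-oo]. *)
Lemma bigmax_seq_attained (disp : Order.disp_t) (T : orderType disp) (x0 : T)
    (s : seq nat) (F : nat -> T) (k : nat) : k \in s -> (forall i, x0 <= F i)%O ->
  exists2 i, i \in s & \big[Order.max/x0]_(j <- s) F j = F i.
Proof.
move=> + F0; elim: s k => // j s IH _ _.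
rewrite big_cons; case: s IH => [|j' s] IH.
  by exists j; rewrite ?mem_head// big_nil; apply/max_idPl.
have [i si ->] := IH j' (mem_head _ _).
have [ji|ij] := leP (F j) (F i).
  by exists i; rewrite // in_cons si orbT.
by exists j; rewrite // mem_head.
Qed.

(** * Vanishing steps under descent relative to window maxima *)

Section NonmonotoneDescent.
Context {R : realType}.
Variables (a d : nat -> R) (c : R) (M : nat).
Hypothesis c_gt0 : 0 < c.
Hypothesis a_ge0 : forall k, 0 <= a k.
Hypothesis d_ge0 : forall k, 0 <= d k.
Hypothesis descent : forall k, exists2 i, (k - M <= i <= k)%N &
  a k.+1 + c * d k ^+ 2 <= a i.
(** Stands for uniform continuity of the objective, in the direction that the backward argument
    uses: it bounds [a k] from below. *)
Hypothesis modulus : forall e, 0 < e -> exists2 r, 0 < r &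
  forall k, d k < r -> a k.+1 <= a k + e.

(** Truncated subtraction encodes the positive part of k - M, and the default 0 does not alter the
    maximum because [a] is nonnegative. *)
Let m k := \big[Num.max/0]_(k - M <= i < k.+1) a i.

Let le_m k i : (k - M <= i <= k)%N -> a i <= m k.
Proof.
by move=> ki; apply: le_bigmax_seq => //; rewrite mem_index_iota ltnS.
Qed.

Let m_attained k : exists2 i, (k - M <= i <= k)%N & m k <= a i.
Proof.
have ks : k \in index_iota (k - M) k.+1.
  by rewrite mem_index_iota leqnn leq_subr.
have [|i] := @bigmax_seq_attained _ _ 0 _ a k ks; first exact: a_ge0.
by rewrite mem_index_iota ltnS => ki mi; exists i; rewrite /m// mi.
Qed.

Let a_le_m k : a k.+1 + c * d k ^+ 2 <= m k.
Proof. by have [i /le_m ki] := descent k; move/le_trans; apply. Qed.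

Let a_le_m' k : a k.+1 <= m k.
Proof.
apply: le_trans (a_le_m k); rewrite lerDl mulr_ge0 ?sqr_ge0//.
exact: ltW.
Qed.

Let m_nincr : {homo m : j k / (j <= k)%N >-> k <= j}.
Proof.
apply: (@homo_leq _ m (fun u w => w <= u)) => [u|v u w uv vw|k].
- exact: lexx.
- exact: le_trans vw uv.
(* A maximizer of the window at k + 1 is either k + 1 itself, which the descent hypothesis controls,
   or already an index of the window at k. *)
have [i /andP[ki]] := m_attained k.+1.
rewrite leq_eqVlt => /orP[/eqP ->|].
  by move/le_trans; apply; exact: a_le_m'.
rewrite ltnS => ik /le_trans; apply; apply: le_m; rewrite ik andbT.
by apply: leq_trans ki; rewrite leq_sub2r.
Qed.

Let inf_m := limn m.

Let m_cvg : cvgn m.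
Proof.
apply: nonincreasing_is_cvgn => //; exists 0 => _ [k _ <-].
exact: bigmax_ge_id.
Qed.

Let inf_m_le k : inf_m <= m k.
Proof. exact: nonincreasing_cvgn_ge. Qed.

(* An index whose successor is close to the limit of the window maxima makes a
   short step, and is therefore itself close to that limit. *)
Let step_back e : 0 < e -> exists2 e', 0 < e' & \forall k \near \oo,
  inf_m - e' <= a k.+1 -> d k < e /\ inf_m - e <= a k.
Proof.
move=> e0; have [|r r0 Hr] := modulus (e / 2); first by rewrite divr_gt0.
pose q := Num.min r e; have q0 : 0 < q by rewrite lt_min r0 e0.
(* A step of length at least q would lower the value by c q^2, more than the gap 2 e' available
   between m k and [a k.+1]. The bound e/2 leaves the other half of e for the modulus. *)
pose e' := Num.min (e / 2) (c * q ^+ 2 / 4).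
have e'0 : 0 < e' by rewrite lt_min !divr_gt0// mulr_gt0// exprn_gt0.
exists e' => //; near=> k => ak.
have mk : m k < inf_m + e'.
  by near: k; apply: (cvgr_lt inf_m m_cvg); rewrite ltrDl.
have dq : d k < q.
  rewrite ltNge; apply/negP => qd.
  have q2 : c * q ^+ 2 <= c * d k ^+ 2.
    by rewrite ler_wpM2l ?(ltW c_gt0)// lerXn2r ?nnegrE ?d_ge0 ?(ltW q0).
  have := a_le_m k; have : e' <= c * q ^+ 2 / 4 by rewrite ge_min lexx orbT.
  have : 0 < c * q ^+ 2 by rewrite mulr_gt0// exprn_gt0.
  lra.
have [qr qe] : q <= r /\ q <= e by rewrite !ge_min !lexx orbT.
split; first exact: lt_le_trans dq qe.
have := Hr k (lt_le_trans dq qr).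
have : e' <= e / 2 by rewrite ge_min lexx.
lra.
Unshelve. all: by end_near. Qed.

(** Iterates [step_back], with a smaller tolerance at each level; the number of backward steps must
    be bounded in advance for e' and N to be uniform. *)
Let steps_back J e : 0 < e -> exists2 e', 0 < e' & exists N, forall k j,
  (N <= k)%N -> (j < J)%N -> inf_m - e' <= a (k + j).+1 ->
  d k < e /\ inf_m - e <= a k.
Proof.
elim: J e => [|J IH] e e0; first by exists 1 => //; exists 0%N.
have [e1 e10 [N1 _ H1]] := step_back e e0.
have [e2 e20 [N2 H2]] := IH e1 e10.
exists (Num.min e1 e2); first by rewrite lt_min e10.
exists (maxn N1 N2) => k j; rewrite geq_max => /andP[N1k N2k] jJ ak.
have [e1m e2m] : inf_m - e1 <= inf_m - Num.min e1 e2 /\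
    inf_m - e2 <= inf_m - Num.min e1 e2.
  by rewrite !lerD2l !lerN2 !ge_min !lexx orbT.
apply: (H1 k N1k); case: j jJ ak => [|j] jJ ak.
  by rewrite addn0 in ak; apply: le_trans ak.
apply: (H2 k.+1 j (leqW N2k) jJ _).2.
by rewrite addSnnS; apply: le_trans ak.
Qed.

Lemma nonmonotone_descent_cvg0 : d k @[k --> \oo] --> 0.
Proof.
apply/cvgrPdist_lt => e e0; have [e' e'0 [N H]] := steps_back M.+1 e e0.
exists N => // k /= Nk; rewrite sub0r normrN ger0_norm//.
(* The window ending at k + M + 1 starts at k + 1, so its maximizer i comes after k, and at most M +
   1 backward steps lead from i to k. *)
have [i /andP[ki ik] mi] := m_attained (k + M).+1.
have ki' : (k < i)%N by apply: leq_trans ki; rewrite -addSn addnK.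
have jM : (i - k.+1 < M.+1)%N by rewrite ltn_subLR// addSn ltnS addnS.
have ai : inf_m - e' <= a (k + (i - k.+1)).+1.
  rewrite -addSn subnKC//; apply: le_trans mi; apply: le_trans (inf_m_le _).
  by rewrite gerBl ltW.
by have [] := H k _ Nk jM ai.
Qed.

End NonmonotoneDescent.

(** * Algebra of the sign that never vanishes *)

Section Sign.
Context {R : realType}.
Implicit Types t u : R.

Lemma sgn1_mulr_norm t : sgn1 t * `|t| = t.
Proof.
rewrite /sgn1; case: ifPn => [t0|]; first by rewrite ger0_norm// mul1r.
by rewrite -ltNge => t0; rewrite ltr0_norm// mulN1r opprK.
Qed.

Lemma sgn1_sqr t : sgn1 t * sgn1 t = 1.
Proof. by rewrite /sgn1; case: ifP; rewrite ?mulr1// mulrNN mulr1. Qed.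

Lemma normr_sgn1M t u : `|sgn1 t * u| = `|u|.
Proof. by rewrite /sgn1; case: ifP; rewrite ?mul1r// mulN1r normrN. Qed.

End Sign.

(** * One step of the algorithm: sufficient decrease and acceptance of large eta *)

Section DoublyMajorizedStep.
Context {R : realType} {n : nat}.
Variables (f : 'rV[R]_n -> R) (Lf lambda : R).
Variables (psi phi : R -> R) (Omega : set 'rV[R]_n).
Hypothesis f_diff : forall y, differentiable f y.
Hypothesis Lf_gt0 : 0 < Lf.
Hypothesis grad_lip : forall y z,
  enorm (grad f y - grad f z) <= Lf * enorm (y - z).
Hypothesis lambda_gt0 : 0 < lambda.
Hypothesis HA : assumptionA psi phi Omega.
Implicit Types x u v : 'rV[R]_n.

(** The finite part of the objective, which lets the estimates at feasible points be made in R.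
    Despite the name it need not be differentiable. *)
Definition smooth_objective x : R := f x + lambda * \sum_(i < n) psi `|x 0 i|.

Local Notation F := smooth_objective.
Local Notation psiOmega := (map_mx psi @` Omega).
Local Notation G := (Gfun f phi lambda).
Local Notation Q := (surrogate f phi lambda).

Lemma map_psi_absvE x i : map_mx psi (absv x) 0 i = psi `|x 0 i|.
Proof. by rewrite !mxE. Qed.

Lemma objectiveE x : Omega (absv x) -> objective f psi Omega lambda x = (F x)%:E.
Proof.
by move=> Ox; rewrite /objective /delta (mem_set Ox) adde0.
Qed.

Lemma absv_candidate g x y : Omega y ->
  absv (candidate f phi g x (map_mx psi y)) = y.
Proof.
move=> Oy; apply/rowP => i; have y0 := A_Omega_ge0 HA Oy i.
by rewrite !mxE normr_sgn1M (A_psiK HA)// ger0_norm.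
Qed.

Lemma candidate_psiOmega g x v : psiOmega v ->
  Omega (absv (candidate f phi g x v)) /\
  v = map_mx psi (absv (candidate f phi g x v)).
Proof. by move=> [y Oy <-]; rewrite absv_candidate. Qed.

(** Let w = x - g grad f(x). The candidate u carries the signs of w, so (|u_i| - |w_i|)^2 = (u_i -
    w_i)^2, while (|x_i| - |w_i|)^2 <= (x_i - w_i)^2 for the old point. Hence a decrease of [G]
    implies a proximal gradient decrease, and the descent lemma with Lf + c <= 1/g concludes. *)
Lemma sufficient_decrease g c x v : 0 < g -> (Lf + c) * g <= 1 -> psiOmega v ->
  G g x v <= G g x (map_mx psi (absv x)) ->
  F (candidate f phi g x v) + c / 2 * enorm (candidate f phi g x v - x) ^+ 2
    <= F x.
Proof.
move=> g0 gc /(candidate_psiOmega g x)[_ vE] GG.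
set u := candidate f phi g x v in vE *.
have phiu i : phi (v 0 i) = `|u 0 i|.
  by rewrite vE !mxE (A_psiK HA).
have psiu i : v 0 i = psi `|u 0 i| by rewrite [in LHS]vE !mxE.
have uE i : u 0 i = sgn1 (x 0 i - g * grad f x 0 i) * `|u 0 i|.
  by rewrite -phiu /u mxE.
have H1 : \sum_(i < n) ((2 * g)^-1 * (u 0 i - x 0 i) ^+ 2
     + grad f x 0 i * (u 0 i - x 0 i)) <=
   \sum_(i < n) gfun f phi g x i (v 0 i) -
   \sum_(i < n) gfun f phi g x i (map_mx psi (absv x) 0 i).
  rewrite -sumrB; apply: ler_sum => i _.
  rewrite /gfun map_psi_absvE (A_psiK HA)// phiu.
  set w := x 0 i - g * _.
  have -> : (`|u 0 i| - `|w|) ^+ 2 = (u 0 i - w) ^+ 2.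
    have -> : u 0 i - w = sgn1 w * (`|u 0 i| - `|w|).
      by rewrite mulrBr sgn1_mulr_norm; congr (_ - _); exact: uE.
    by rewrite exprMn [sgn1 w ^+ 2]expr2 sgn1_sqr mul1r.
  have H : (`|x 0 i| - `|w|) ^+ 2 <= (x 0 i - w) ^+ 2.
    rewrite -real_normK ?num_real// -[leRHS]real_normK ?num_real//.
    by rewrite lerXn2r ?nnegrE// ler_dist_dist.
  have g2 : 0 <= (2 * g)^-1 by rewrite invr_ge0 mulr_ge0// ltW.
  have := ler_wpM2l g2 H.
  have -> : (2 * g)^-1 * (u 0 i - x 0 i) ^+ 2 +
     grad f x 0 i * (u 0 i - x 0 i) =
    (2 * g)^-1 * (u 0 i - w) ^+ 2 - (2 * g)^-1 * (x 0 i - w) ^+ 2.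
    by rewrite /w; field; rewrite gt_eqF.
  lra.
have H2 := grad_lipschitz_descent f Lf x u f_diff Lf_gt0 grad_lip.
rewrite big_split/= -mulr_sumr in H1.
have E : \sum_(i < n) (u 0 i - x 0 i) ^+ 2 = enorm (u - x) ^+ 2.
  by rewrite enorm_sqr; apply: eq_bigr => i _; rewrite !mxE.
rewrite E in H1.
have H3 : (Lf + c) / 2 * enorm (u - x) ^+ 2 <= (2 * g)^-1 * enorm (u - x) ^+ 2.
  rewrite ler_wpM2r ?sqr_ge0// invfM mulrC ler_wpM2l// -[g^-1]div1r.
  by rewrite ler_pdivlMr.
move: GG; rewrite /Gfun /F.
have -> : \sum_(i < n) v 0 i = \sum_(i < n) psi `|u 0 i|.
  by apply: eq_bigr => i _.
have -> : \sum_(i < n) map_mx psi (absv x) 0 i = \sum_(i < n) psi `|x 0 i|.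
  by apply: eq_bigr => i _; rewrite !mxE.
lra.
Qed.

Lemma surrogate_at g eta x v : Q g eta x v v = 0.
Proof.
rewrite /surrogate enorm_sqr !big1 ?mulr0 ?addr0// => i _.
  by rewrite subrr mulr0.
by rewrite !mxE subrr expr0n.
Qed.

(** Completing the square in each coordinate absorbs the linear term into half of the quadratic one.
    The bound depends on [etal] only, so the minimizer is confined before eta is taken large. *)
Lemma surrogate_sublevel_bound g eta etal C x v w : 0 < etal -> etal <= eta ->
  (forall i, `|lambda + rderiv (gfun f phi g x i) (v 0 i)| <= C) ->
  Q g eta x v w <= 0 -> enorm (w - v) ^+ 2 <= 4 * (n%:R * C ^+ 2) / etal ^+ 2.
Proof.
move=> etal0 etaleta HC.
have eta0 : 0 < eta := lt_le_trans etal0 etaleta.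
set c := fun i => lambda + rderiv (gfun f phi g x i) (v 0 i).
have -> : Q g eta x v w = eta / 2 * \sum_(i < n) (w 0 i - v 0 i) ^+ 2 +
    \sum_(i < n) c i * (w 0 i - v 0 i).
  rewrite /surrogate enorm_sqr; congr (_ * _ + _).
  by apply: eq_bigr => i _; rewrite !mxE.
rewrite mulr_sumr -big_split/= => H.
have H1 : \sum_(i < n) (eta / 4 * (w 0 i - v 0 i) ^+ 2 - eta^-1 * c i ^+ 2) <= 0.
  apply: le_trans H; apply: ler_sum => i _.
  rewrite -subr_ge0.
  set d := w 0 i - v 0 i; set ci := c i.
  have -> : eta / 2 * d ^+ 2 + ci * d - (eta / 4 * d ^+ 2 - eta^-1 * ci ^+ 2) =
     (eta / 2 * d + ci) ^+ 2 / eta by field; rewrite gt_eqF.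
  by rewrite divr_ge0 ?sqr_ge0// ltW.
move: H1; rewrite sumrB -!mulr_sumr subr_le0.
have -> : \sum_(i < n) (w 0 i - v 0 i) ^+ 2 = enorm (w - v) ^+ 2.
  by rewrite enorm_sqr; apply: eq_bigr => i _; rewrite !mxE.
set D := enorm _ ^+ 2; have D0 : 0 <= D by exact: sqr_ge0.
have S : \sum_(i < n) c i ^+ 2 <= n%:R * C ^+ 2.
  rewrite mulr_natl -[X in _ *+ X]card_ord -sumr_const; apply: ler_sum => i _.
  have C0 := le_trans (normr_ge0 _) (HC i).
  by rewrite -real_normK ?num_real// lerXn2r ?nnegrE ?HC.
move=> H1; rewrite ler_pdivlMr ?exprn_gt0//.
have ei0 : 0 <= eta^-1 by rewrite invr_ge0 ltW.
have {}H1 : eta * (eta / 4 * D) <= n%:R * C ^+ 2.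
  by apply: le_trans S; rewrite -ler_pdivlMl.
have : etal ^+ 2 * D <= eta ^+ 2 * D.
  by rewrite ler_wpM2r// lerXn2r ?nnegrE ?(ltW eta0) ?(ltW etal0).
lra.
Qed.

(* For a large enough eta the surrogate majorizes G on the bounded set where its
   minimizer lies. *)
Lemma eta_test_uniform (B gl etal A : R) : 0 <= B -> 0 < gl -> 0 < etal ->
  0 <= A ->
  exists2 K, 0 < K & forall g eta x w, gl <= g -> etal <= eta -> K <= eta ->
    Omega (absv x) -> (forall i, psi `|x 0 i| <= B) ->
    (forall i, `|x 0 i - g * grad f x 0 i| <= A) ->
    argmin psiOmega (Q g eta x (map_mx psi (absv x))) w ->
    G g x w <= G g x (map_mx psi (absv x)).
Proof.
move=> B0 gl0 etal0 A0.
pose P := `|rderiv phi 0| + `|rderiv phi B|.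
have P0 : 0 <= P by rewrite addr_ge0.
have phiB0 := A_phi_ge0 HA B0.
pose C := lambda + gl^-1 * (phi B + A) * P.
pose D := 4 * (n%:R * C ^+ 2) / etal ^+ 2.
have D0 : 0 <= D.
  by apply: divr_ge0; rewrite ?exprn_ge0 ?(ltW etal0)// mulr_ge0// mulr_ge0// sqr_ge0.
(* D bounds the squared distance from v to the minimizer, so each coordinate moves by at most 1 + D,
   since r^2 <= D implies r <= 1 + D. The majorant is therefore taken on [0, B + 1 + D]. *)
have BD0 : 0 <= B + (1 + D) by rewrite !addr_ge0.
have [K K0 HK] := half_sqr_majorant psi phi Omega HA (B + (1 + D)) A gl BD0 A0 gl0.
exists K => // g eta x w glg etaleta Keta Ox psiB wA [[y Oy yw] wmin].
set v := map_mx psi (absv x) in wmin *.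
have g0 : 0 < g := lt_le_trans gl0 glg.
have vE i : v 0 i = psi `|x 0 i| by rewrite !mxE.
have v0B i : 0 <= v 0 i <= B by rewrite vE psiB (A_psi_ge0 HA).
have cC i : `|lambda + rderiv (gfun f phi g x i) (v 0 i)| <= C.
  have /andP[vi0 viB] := v0B i.
  rewrite /C (le_trans (ler_normD _ _))// (ger0_norm (ltW lambda_gt0)) lerD2l.
  rewrite [rderiv _ _](rderiv_half_sqr psi phi Omega HA)//.
  have -> : 2 * (2 * g)^-1 = g^-1 by field; rewrite gt_eqF.
  rewrite !normrM; apply: ler_pM; rewrite ?mulr_ge0//; last first.
    exact: (phi_rderiv_bound psi phi Omega HA).
  apply: ler_pM => //.
    by rewrite ger0_norm ?invr_ge0 ?(ltW g0)// lef_pV2.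
  apply: le_trans (ler_normB _ _) _; rewrite normr_id lerD ?wA//.
  rewrite ger0_norm ?(A_phi_ge0 HA)//.
  exact: (phi_le psi phi Omega HA).
have Qw : Q g eta x v w <= 0.
  by rewrite -(surrogate_at g eta x v); apply: wmin; exists (absv x).
have Dw := surrogate_sublevel_bound g eta etal C x v w etal0 etaleta cC Qw.
have w0B i : 0 <= w 0 i <= B + (1 + D).
  have y0 := A_Omega_ge0 HA Oy i.
  rewrite -{1}yw mxE (A_psi_ge0 HA)//=.
  have := coord_le_enorm (w - v) i; rewrite !mxE => /(le_trans (ler_norm _)).
  have /andP[_] := v0B i; rewrite vE; rewrite -/D in Dw.
  have := enorm_ge0 (w - v); nra.
have v0B' i : 0 <= v 0 i <= B + (1 + D).
  by have /andP[-> /le_trans] := v0B i; apply; rewrite lerDl addr_ge0.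
move: Qw; rewrite /surrogate /Gfun enorm_sqr => Qw.
have H : \sum_(i < n) gfun f phi g x i (w 0 i) <=
   \sum_(i < n) (gfun f phi g x i (v 0 i) +
     rderiv (gfun f phi g x i) (v 0 i) * (w 0 i - v 0 i) +
     K / 2 * (w 0 i - v 0 i) ^+ 2).
  by apply: ler_sum => i _; apply: HK => //; rewrite normr_ge0 wA.
have E : \sum_(i < n) (lambda + rderiv (gfun f phi g x i) (v 0 i)) *
     (w 0 i - v 0 i) = lambda * \sum_(i < n) w 0 i - lambda * \sum_(i < n) v 0 i +
    \sum_(i < n) rderiv (gfun f phi g x i) (v 0 i) * (w 0 i - v 0 i).
  rewrite -mulrBr -sumrB mulr_sumr -big_split/=.
  by apply: eq_bigr => i _; rewrite mulrDl.
have E2 : \sum_(i < n) (w - v) 0 i ^+ 2 = \sum_(i < n) (w 0 i - v 0 i) ^+ 2.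
  by apply: eq_bigr => i _; rewrite !mxE.
rewrite E E2 in Qw.
rewrite 2!big_split/= -(mulr_sumr _ _ _ (K / 2)) in H.
set S := \sum_(i < n) (w 0 i - v 0 i) ^+ 2 in H Qw.
have S0 : 0 <= S by rewrite sumr_ge0// => i _; exact: sqr_ge0.
have : K * S <= eta * S by rewrite ler_wpM2r.
lra.
Qed.

End DoublyMajorizedStep.

(** * Signs in the limit *)

Lemma sgn1_gt0M {R : realType} (t u : R) : 0 < u -> sgn1 (sgn1 t * u) = sgn1 t.
Proof.
move=> u0; rewrite {2 3}/sgn1; case: ifP => _.
  by rewrite mul1r /sgn1 (ltW u0).
by rewrite mulN1r /sgn1 oppr_ge0 leNgt u0.
Qed.

Lemma sgn1_near {R : realType} (t l : R) : `|t - l| < `|l| -> sgn1 t = sgn1 l.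
Proof.
rewrite /sgn1; case: (leP 0 l) => l0.
  by rewrite (ger0_norm l0) ltr_norml => tl; rewrite ifT//; lra.
rewrite (ltr0_norm l0) ltr_norml => tl; rewrite ifF//.
by apply/negbTE; rewrite -ltNge; lra.
Qed.

Lemma cvg_le_dist {R : realType} (u e : nat -> R) (l : R) :
  (forall j, `|u j - l| <= e j) -> e @ \oo --> 0 -> u @ \oo --> l.
Proof.
move=> ue /cvgrPdist_lt e0; apply/cvgrPdist_lt => q q0.
have := e0 q q0; apply: filterS => j; rewrite sub0r normrN distrC.
exact/le_lt_trans/(le_trans (ue j))/ler_norm.
Qed.

(* The sign constraint linking two consecutive iterates makes the step size
   cancel in the limit of this quotient, so no convergence of [g] is needed. *)
Lemma cvg_sign_quotient {R : realType} (X X' D g : nat -> R) (l d gl : R) :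
  0 < gl -> (forall j, gl <= g j) ->
  X @ \oo --> l -> X' @ \oo --> l -> D @ \oo --> d ->
  (forall j, X' j = sgn1 (X j - g j * D j) * `|X' j|) ->
  (g j)^-1 * (`|X j| - `|X j - g j * D j|) @[j --> \oo] -->
    (if l == 0 then - sgn1 d else sgn1 l) * d.
Proof.
move=> gl0 glg Xl X'l Dd X'E.
have g0 j : 0 < g j := lt_le_trans gl0 (glg j).
have [l0|l0] := eqVneq l 0.
  have -> : - sgn1 d * d = - `|d|.
    by rewrite -{2}(sgn1_mulr_norm d) mulNr mulrA sgn1_sqr mul1r.
  apply: (@cvg_le_dist _ _ (fun j => 2 * gl^-1 * `|X j| + `|D j - d|)).
    move=> j; set w := X j - _; set rho := _^-1 * _.
    (* As g |D| = |w - X|, the left side is 1/g times | |X| - (|w| - |w - X|) |, and each of the two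
       terms is at most |X|, which tends to 0. *)
    have H1 : `|rho + `|D j| | <= 2 * gl^-1 * `|X j|.
      have -> : rho + `|D j| = (g j)^-1 * (`|X j| - (`|w| - `|w - X j|)).
        rewrite /w [_ - _ - _]addrAC subrr sub0r normrN normrM (gtr0_norm (g0 j)).
        by rewrite /rho; field; rewrite gt_eqF.
      rewrite normrM gtr0_norm ?invr_gt0//.
      have -> : 2 * gl^-1 * `|X j| = gl^-1 * (2 * `|X j|) by ring.
      apply: ler_pM => //; first by rewrite invr_ge0 ltW.
        by rewrite lef_pV2 ?posrE ?g0.
      have := ler_dist_dist w (w - X j).
      rewrite opprB addrCA subrr addr0 => H.
      apply: le_trans (ler_normB _ _) _; rewrite normr_id; lra.
    have H2 := ler_dist_dist (D j) d.
    have -> : rho - - `|d| = (rho + `|D j|) - (`|D j| - `|d|) by ring.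
    by apply: le_trans (ler_normB _ _) _; exact: lerD.
  have -> : (0 : R) = 2 * gl^-1 * `|l| + `|d - d|.
    by rewrite l0 subrr normr0 mulr0 addr0.
  apply: cvgD.
    by apply: cvgM; [exact: cvg_cst | exact: cvg_norm].
  by apply: cvg_norm; apply: cvgB => //; exact: cvg_cst.
have nl : 0 < `|l| by rewrite normr_gt0.
have H : sgn1 l * D j @[j --> \oo] --> sgn1 l * d.
  by apply: cvgM => //; exact: cvg_cst.
apply: cvg_trans H; apply: near_eq_cvg; near=> j.
have Xj : `|X j - l| < `|l|.
  by rewrite distrC; near: j; move/cvgrPdist_lt : Xl; apply.
have X'j : `|X' j - l| < `|l|.
  by rewrite distrC; near: j; move/cvgrPdist_lt : X'l; apply.
have X'0 : 0 < `|X' j|.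
  rewrite normr_gt0; apply/eqP => E.
  by rewrite E sub0r normrN ltxx in X'j.
(* The point w itself need not converge; its sign is read off the next iterate X', which is close to
   l and nonzero. *)
have sw : sgn1 (X j - g j * D j) = sgn1 l.
  by rewrite -(sgn1_near _ _ X'j) X'E sgn1_gt0M.
have normE t : sgn1 t = sgn1 l -> `|t| = sgn1 l * t.
  by move=> <-; rewrite -{3}(sgn1_mulr_norm t) mulrA sgn1_sqr mul1r.
rewrite (normE _ (sgn1_near _ _ Xj)) (normE _ sw).
by field; rewrite gt_eqF.
Unshelve. all: by end_near. Qed.

(** * Continuity of the objective and of the quantities in the stationarity condition *)

Section Modulus.
Context {R : realType} {n : nat}.
Variables (f : 'rV[R]_n -> R) (Lf lambda : R).
Variables (psi phi : R -> R) (Omega : set 'rV[R]_n).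
Hypothesis f_diff : forall y, differentiable f y.
Hypothesis Lf_gt0 : 0 < Lf.
Hypothesis grad_lip : forall y z,
  enorm (grad f y - grad f z) <= Lf * enorm (y - z).
Hypothesis lambda_gt0 : 0 < lambda.
Hypothesis HA : assumptionA psi phi Omega.
Implicit Types x u v : 'rV[R]_n.

Local Notation F := (smooth_objective f lambda psi).

Lemma smooth_objective_modulus (C e : R) : 0 <= C -> 0 < e ->
  exists2 r, 0 < r & forall x u, (forall i, `|grad f x 0 i| <= C) ->
    enorm (u - x) < r -> F u <= F x + e.
Proof.
(* Using n + 1 instead of n avoids a division by zero in dimension 0. *)
move=> C0 e0; pose e1 := e / (2 * lambda * n.+1%:R).
have e10 : 0 < e1 by rewrite divr_gt0 ?mulr_gt0.
pose r2 := e / (2 * (n%:R * C + Lf)).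
have nCL : 0 < n%:R * C + Lf by rewrite ltr_wpDl// mulr_ge0.
have r20 : 0 < r2 by rewrite divr_gt0 ?mulr_gt0.
(* The bound 1 absorbs d^2 into d, [phi e1] keeps the [psi] part below e/2 through [psi_dist], and
   [r2] does the same for the part coming from f. *)
exists (Num.min 1 (Num.min (phi e1) r2)).
  by rewrite !lt_min ltr01 r20 (phi_gt0 _ _ _ HA).
move=> x u gC; rewrite !lt_min; set d := enorm _ => /and3P[d1 dphi dr2].
have d0 : 0 <= d by exact: enorm_ge0.
have di i : `|u 0 i - x 0 i| <= d.
  by have := coord_le_enorm (u - x) i; rewrite !mxE.
have H1 : \sum_(i < n) grad f x 0 i * (u 0 i - x 0 i) <= n%:R * C * d.
  rewrite -mulrA mulr_natl -[X in _ *+ X]card_ord -sumr_const.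
  apply: ler_sum => i _; apply: le_trans (ler_norm _) _.
  by rewrite normrM; apply: ler_pM.
have H2 : \sum_(i < n) psi `|u 0 i| <= \sum_(i < n) psi `|x 0 i| + n%:R * e1.
  rewrite [X in _ + X]mulr_natl -[X in _ *+ X]card_ord -sumr_const -big_split/=.
  apply: ler_sum => i _.
  have := psi_dist _ _ _ HA _ _ (normr_ge0 (u 0 i)) (normr_ge0 (x 0 i)).
  move/(le_trans (ler_norm _)); rewrite lerBlDl => /le_trans; apply.
  rewrite lerD2l -[leRHS](A_phiK HA) ?(ltW e10)//.
  apply: (psi_le _ _ _ HA) => //; apply: le_trans (ltW dphi).
  exact: le_trans (ler_dist_dist _ _) (di i).
have H3 := grad_lipschitz_descent f Lf x u f_diff Lf_gt0 grad_lip.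
rewrite -/d in H3.
have H4 : lambda * (n%:R * e1) <= e / 2.
  have -> : lambda * (n%:R * e1) = n%:R / n.+1%:R * (e / 2).
    by rewrite /e1; field; rewrite gt_eqF ?ltr_pwDl ?gt_eqF.
  rewrite ler_piMl ?divr_ge0 ?(ltW e0)// ler_pdivrMr ?ltr0n// mul1r.
  by rewrite ler_nat.
have H5 : (n%:R * C + Lf) * d <= e / 2.
  have -> : e / 2 = (n%:R * C + Lf) * r2 by rewrite /r2; field; rewrite gt_eqF.
  by rewrite ler_wpM2l ?ltW.
have H6 : Lf / 2 * d ^+ 2 <= Lf * d.
  have : Lf * d ^+ 2 <= Lf * d by rewrite ler_wpM2l ?(ltW Lf_gt0)//; nra.
  have : 0 <= Lf * d by rewrite mulr_ge0// ltW.
  lra.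
rewrite /smooth_objective.
have := ler_wpM2l (ltW lambda_gt0) H2.
lra.
Qed.

Lemma cvg_psi_norm (u : nat -> R) (l : R) : u @ \oo --> l ->
  psi `|u j| @[j --> \oo] --> psi `|l|.
Proof.
move=> /cvgrPdist_lt ul; apply/cvgrPdist_lt => e e0.
have := ul _ (phi_gt0 _ _ _ HA _ e0); apply: filterS => j lj.
apply: le_lt_trans (psi_dist _ _ _ HA _ _ (normr_ge0 _) (normr_ge0 _)) _.
rewrite -[ltRHS](A_phiK HA) ?(ltW e0)//.
apply: (psi_lt _ _ _ HA) => //.
exact: le_lt_trans (ler_dist_dist _ _) lj.
Qed.

Lemma cvg_rderiv_phi (u : nat -> R) (l : R) : (forall j, 0 <= u j) -> 0 <= l ->
  u @ \oo --> l -> rderiv phi (u j) @[j --> \oo] --> rderiv phi l.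
Proof.
move=> u0 l0 ul.
have [C C0 HC] := phi_rderiv_lipschitz _ _ _ HA (l + 1) (addr_ge0 l0 ler01).
apply/cvgrPdist_lt => e e0.
have /cvgrPdist_lt ul' := ul; near=> j.
have d1 : `|l - u j| < 1 by near: j; exact: ul'.
have d2 : `|l - u j| < e / (C + 1).
  by near: j; apply: ul'; rewrite divr_gt0// ltr_wpDl.
move: d2; rewrite ltr_pdivlMr ?ltr_wpDl// => d2.
have uB : 0 <= u j <= l + 1.
  by rewrite u0/=; move: d1; rewrite ltr_norml; lra.
have lB : 0 <= l <= l + 1 by rewrite l0 lerDl ler01.
apply: le_lt_trans (HC _ _ lB uB) _; apply: le_lt_trans d2.
by have := normr_ge0 (l - u j); lra.
Unshelve. all: by end_near. Qed.

Lemma cvg_grad (y : nat -> 'rV[R]_n) (l : 'rV[R]_n) i :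
  enorm (y j - l) @[j --> \oo] --> 0 ->
  grad f (y j) 0 i @[j --> \oo] --> grad f l 0 i.
Proof.
move=> yl; apply: (@cvg_le_dist _ _ (fun j => Lf * enorm (y j - l))).
  move=> j; apply: le_trans (grad_lip _ _).
  by have := coord_le_enorm (grad f (y j) - grad f l) i; rewrite [X in `|X|]mxE [X in _ + X]mxE.
have -> : (0 : R) = Lf * 0 by rewrite mulr0.
by apply: cvgM => //; exact: cvg_cst.
Qed.

End Modulus.

(** * From sup-norm cluster points to Euclidean subsequences *)

Set Implicit Arguments.
Unset Strict Implicit.

Lemma row_norm_le (R : realType) (n : nat) (y : 'rV[R]_n) (C : R) : 0 <= C ->
  (forall i, `|y 0 i| <= C) -> `|y| <= C.
Proof.
move=> C0 yC; rewrite -[leLHS]/(mx_norm y) mx_normrE; apply: bigmax_le => // -[i j] _.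
by rewrite ord1.
Qed.

(** The index map is only required to tend to infinity, not to increase, so a pointwise choice of
    indices suffices. *)
Lemma cluster_subsequence (R : realType) (n : nat) (y : nat -> 'rV[R]_n)
    (l : 'rV[R]_n) : cluster (y @ \oo) l ->
  exists s : nat -> nat, s @ \oo --> \oo /\ enorm (y (s j) - l) @[j --> \oo] --> 0.
Proof.
move=> cl.
have ex (j : nat) : exists k, (j <= k)%N /\ enorm (y k - l) < j.+1%:R^-1.
  (* The Euclidean norm is at most n times the sup norm, hence a sup-norm ball smaller by the factor
     n + 1. *)
  pose e : R := (j.+1%:R * n.+1%:R)^-1.
  have e0 : 0 < e by rewrite invr_gt0 mulr_gt0.
  have Fj : (y @ \oo) [set z | exists2 k, (j <= k)%N & z = y k].
    by exists j => // k /= jk; exists k.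
  have [_ [[k jk ->] kl]] := cl _ _ Fj (nbhsx_ballx l e e0).
  exists k; split => //.
  have kl' i : `|(y k - l) 0 i| <= e.
    by have := kl.2 0 i; rewrite /ball/= !mxE distrC => /ltW.
  apply: le_lt_trans (enorm_le_sum _) _.
  apply: (@le_lt_trans _ _ (n%:R * e)).
    rewrite mulr_natl -[X in _ *+ X]card_ord -sumr_const.
    by apply: ler_sum => i _; exact: kl'.
  rewrite /e invfM mulrCA gtr_pMr ?invr_gt0// ltr_pdivrMr// mul1r.
  by rewrite ltr_nat.
have [s sP] := choice ex; exists s; split.
  apply/cvgnyPge => A; exists A => // j /= Aj.
  exact: leq_trans Aj (sP j).1.
apply/cvgrPdist_lt => e e0.
have := near_infty_natSinv_lt (PosNum e0); apply: filterS => j /= je.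
rewrite sub0r normrN ger0_norm ?enorm_ge0//.
exact: lt_trans (sP j).2 je.
Qed.

(** * Invariants of the two backtracking loops *)

Section Loops.
Context {R : realType} {n : nat}.
Variables (f : 'rV[R]_n -> R) (Lf lambda : R).
Variables (psi phi : R -> R) (Omega : set 'rV[R]_n).
Variables (gmax etamin etamax c1 tau : R).
Hypothesis f_diff : forall y, differentiable f y.
Hypothesis Lf_gt0 : 0 < Lf.
Hypothesis grad_lip : forall y z,
  enorm (grad f y - grad f z) <= Lf * enorm (y - z).
Hypothesis HA : assumptionA psi phi Omega.
Hypothesis c1_gt0 : 0 < c1.
Hypothesis tau_gt0 : 0 < tau.
Hypothesis tau_lt1 : tau < 1.
Implicit Types (x u v w : 'rV[R]_n) (g eta : R) (Fmax : \bar R).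

Local Notation psiOmega := (map_mx psi @` Omega).
Local Notation G := (Gfun f phi lambda).
Local Notation Q := (surrogate f phi lambda).
Local Notation eta_loop := (eta_loop f psi phi Omega lambda tau).
Local Notation gamma_loop :=
  (gamma_loop f psi phi Omega lambda etamin etamax c1 tau).
Local Notation test := (line_search_test f psi Omega lambda c1).

Lemma eta_loop_exit x v g eta0 eta w : eta_loop x v g eta0 eta w ->
  argmin psiOmega (Q g eta x v) w /\ G g x w <= G g x v.
Proof. by elim=> // {}eta0 {}w ? ? ? ? _ IH. Qed.

(** A rejected eta lies below K, so its successor lies below K / tau. *)
Lemma eta_loop_bound x v g K H eta0 eta w : 0 < etamin ->
  (forall e u, etamin <= e -> K <= e -> argmin psiOmega (Q g e x v) u ->
    G g x u <= G g x v) ->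
  K / tau <= H -> eta_loop x v g eta0 eta w ->
  etamin <= eta0 <= H -> etamin <= eta <= H.
Proof.
move=> etamin0 HK KH; elim=> // e u e' u' Au Gu _ IH /andP[ee eH].
apply: IH; apply/andP; split.
  have e0 := lt_le_trans etamin0 ee.
  by apply: (le_trans ee); rewrite ler_pdivlMr// ler_piMr// ltW.
apply: le_trans KH; rewrite ler_wpM2r ?invr_ge0 ?(ltW tau_gt0)//.
rewrite leNgt; apply/negP => /ltW Ke.
by have := HK e u ee Ke Au; rewrite leNgt Gu.
Qed.

Lemma test_small_stepsize x w g eta0 eta Fmax : 0 < g -> (Lf + c1) * g <= 1 ->
  Omega (absv x) -> (objective f psi Omega lambda x <= Fmax)%E ->
  eta_loop x (map_mx psi (absv x)) g eta0 eta w ->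
  test Fmax x (candidate f phi g x w).
Proof.
move=> g0 gL Ox xF /eta_loop_exit[[wO _] Gw].
have [Ou _] := candidate_psiOmega f psi phi Omega HA g x w wO.
rewrite /line_search_test leeBrDr//; apply: le_trans xF.
rewrite !objectiveE// -EFinD lee_fin.
exact: (sufficient_decrease f Lf lambda psi phi Omega f_diff Lf_gt0 grad_lip HA).
Qed.

(** A rejected step size exceeds 1 / (Lf + c1), so after multiplication by tau it is still at least
    tau / (Lf + c1). *)
Lemma gamma_loop_exit x Fmax g0 g eta w u gl :
  Omega (absv x) -> (objective f psi Omega lambda x <= Fmax)%E ->
  0 < gl -> gl <= tau / (Lf + c1) ->
  gamma_loop x (map_mx psi (absv x)) Fmax g0 g eta w u ->
  gl <= g0 <= gmax ->
  [/\ gl <= g <= gmax,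
      exists2 eta0, etamin <= eta0 <= etamax &
        eta_loop x (map_mx psi (absv x)) g eta0 eta w,
      test Fmax x u & u = candidate f phi g x w].
Proof.
move=> Ox xF gl0 glL; elim=> [{}g0 eta0 {}eta {}w He Le Te|].
  by move=> g0b; split => //; exists eta0.
move=> {}g0 eta0 {}eta {}w g' eta' w' u' He Le nTe _ IH /andP[glg0 g0max].
have g0_gt0 := lt_le_trans gl0 glg0.
have LC : 0 < Lf + c1 by rewrite addr_gt0.
apply: IH; apply/andP; split; last first.
  by apply: le_trans g0max; rewrite ler_piMl// ltW.
apply: (le_trans glL); rewrite ler_pM2l// -[leLHS]div1r ler_pdivrMr// mulrC.
rewrite leNgt; apply/negP => /ltW gL; apply: nTe.
exact: test_small_stepsize Le.
Qed.

End Loops.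

(** * The generated sequences: feasibility, boundedness, vanishing steps, stationarity *)

Section Iterates.
Context {R : realType} {n : nat}.
Variables (f : 'rV[R]_n -> R) (Lf lambda : R).
Variables (psi phi : R -> R) (Omega : set 'rV[R]_n).
Variables (gmin gmax etamin etamax c1 tau : R) (M : nat).
Variables (x v : nat -> 'rV[R]_n) (gamma_ etabar : nat -> R).
Hypothesis f_ge0 : forall y, 0 <= f y.
Hypothesis f_diff : forall y, differentiable f y.
Hypothesis Lf_gt0 : 0 < Lf.
Hypothesis grad_lip : forall y z,
  enorm (grad f y - grad f z) <= Lf * enorm (y - z).
Hypothesis lambda_gt0 : 0 < lambda.
Hypothesis HA : assumptionA psi phi Omega.
Hypothesis gmin_gt0 : 0 < gmin.
Hypothesis etamin_gt0 : 0 < etamin.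
Hypothesis c1_gt0 : 0 < c1.
Hypothesis tau_gt0 : 0 < tau.
Hypothesis tau_lt1 : tau < 1.
Hypothesis dma : generated_by_DMA f psi phi Omega lambda
  gmin gmax etamin etamax c1 tau M x v gamma_ etabar.

Local Notation F := (smooth_objective f lambda psi).
Local Notation psiOmega := (map_mx psi @` Omega).
Local Notation G := (Gfun f phi lambda).
Local Notation Q := (surrogate f phi lambda).
Local Notation d k := (enorm (x k.+1 - x k)).

Let gl := Num.min gmin (tau / (Lf + c1)).

Let gl_gt0 : 0 < gl.
Proof. by rewrite lt_min gmin_gt0 divr_gt0// addr_gt0. Qed.

(** Feasibility at k is assumed here because the induction that establishes it goes through this
    very step. *)
Let step k : Omega (absv (x k)) -> v k = map_mx psi (absv (x k)) ->
  [/\ gl <= gamma_ k <= gmax,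
      exists2 eta0, etamin <= eta0 <= etamax &
        eta_loop f psi phi Omega lambda tau (x k) (v k) (gamma_ k)
          eta0 (etabar k) (v k.+1),
      line_search_test f psi Omega lambda c1
        (\big[maxe/-oo%E]_((k - M)%N <= i < k.+1)
           objective f psi Omega lambda (x i)) (x k) (x k.+1) &
      x k.+1 = candidate f phi (gamma_ k) (x k) (v k.+1)].
Proof.
move=> Ox vE; have [g0 /andP[g0min g0max]] := DMA_step dma k.
rewrite vE => loop.
apply: (gamma_loop_exit f_diff Lf_gt0 grad_lip HA c1_gt0 tau_gt0 tau_lt1 Ox
  _ gl_gt0 _ loop).
- apply: (le_bigmax_seq _ _ xpredT
    (fun i => objective f psi Omega lambda (x i))) => //.
  by rewrite mem_index_iota leqnn leq_subr.
- by rewrite ge_min lexx orbT.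
- by rewrite g0max ge_min g0min.
Qed.

Lemma DMA_feasible k : Omega (absv (x k)) /\ v k = map_mx psi (absv (x k)).
Proof.
elim: k => [|k [Ox vE]]; first by split; [exact: DMA_x0 dma | exact: DMA_v0 dma].
have [_ [eta0 _ /eta_loop_exit[[vO _] _]] _ xE] := step Ox vE.
rewrite xE; exact: (candidate_psiOmega f psi phi Omega HA).
Qed.

Let Ox k : Omega (absv (x k)) := (DMA_feasible k).1.
Let vE k : v k = map_mx psi (absv (x k)) := (DMA_feasible k).2.

Lemma DMA_descent k : exists2 i, (k - M <= i <= k)%N &
  F (x k.+1) + c1 / 2 * d k ^+ 2 <= F (x i).
Proof.
have [_ _ T _] := step (Ox k) (vE k).
have ks : k \in index_iota (k - M) k.+1.
  by rewrite mem_index_iota leqnn leq_subr.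
(* The window maximum is the value at a feasible iterate, hence finite, which turns the test into an
   inequality of reals. *)
have [i|i] := bigmax_seq_attained _ _ (-oo%E : \bar R) _
  (fun i => objective f psi Omega lambda (x i)) k ks; first exact: leNye.
rewrite mem_index_iota ltnS => ki E; exists i => //.
by move: T; rewrite /line_search_test E leeBrDr// (objectiveE _ _ _ _ _ (Ox i)) (objectiveE _ _ _ _ _ (Ox k.+1)) -EFinD lee_fin.
Qed.

Lemma DMA_monotone k : F (x k) <= F (x 0%N).
Proof.
(* Strong induction, since the iterate k + 1 is compared with an arbitrary index of its window. *)
have [m] := ubnP k; elim: m k => // m IH [|k] //; rewrite ltnS => km.
have [i /andP[_ ik] Hi] := DMA_descent k.
apply: (@le_trans _ _ (F (x i))); last first.
  by apply: IH; exact: leq_ltn_trans ik km.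
by apply: le_trans Hi; rewrite lerDl mulr_ge0 ?sqr_ge0// divr_ge0// ltW.
Qed.

Lemma smooth_objective_ge0 y : 0 <= F y.
Proof.
rewrite /smooth_objective addr_ge0// mulr_ge0 ?(ltW lambda_gt0)//.
by rewrite sumr_ge0// => i _; exact: (A_psi_ge0 HA).
Qed.

(** As f and [psi] are nonnegative, lambda times each psi(|x_i|) is at most F(x) <= F(x^0); this is
    where the bounds on the iterates come from. *)
Let B := F (x 0%N) / lambda.

Let B_ge0 : 0 <= B. Proof. by rewrite divr_ge0 ?smooth_objective_ge0// ltW. Qed.

Let psi_le_B k i : psi `|x k 0 i| <= B.
Proof.
rewrite /B ler_pdivlMr// mulrC; apply: le_trans (DMA_monotone k).
rewrite /smooth_objective ler_wpDl// ler_wpM2l ?(ltW lambda_gt0)//.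
rewrite (bigD1 i)//= lerDl sumr_ge0// => j _; exact: (A_psi_ge0 HA).
Qed.

Lemma DMA_coord_le k i : `|x k 0 i| <= phi B.
Proof.
rewrite -[leLHS](A_psiK HA)//; apply: (phi_le _ _ _ HA) => //.
exact: (A_psi_ge0 HA).
Qed.

Let Cg := \sum_(i < n) `|grad f 0 0 i| + Lf * (n%:R * phi B).

Let Cg_ge0 : 0 <= Cg.
Proof.
by rewrite addr_ge0 ?sumr_ge0// !mulr_ge0 ?(ltW Lf_gt0)//; exact: (A_phi_ge0 HA).
Qed.

Let grad_le k i : `|grad f (x k) 0 i| <= Cg.
Proof.
have -> : grad f (x k) 0 i = grad f 0 0 i + (grad f (x k) - grad f 0) 0 i.
  by rewrite [X in _ = _ + X]mxE [X in _ = _ + (_ + X)]mxE addrC subrK.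
apply: le_trans (ler_normD _ _) _; apply: lerD.
  by rewrite (bigD1 i)//= lerDl sumr_ge0.
apply: le_trans (coord_le_enorm _ i) _; apply: le_trans (grad_lip _ _) _.
rewrite ler_wpM2l ?(ltW Lf_gt0)// subr0; apply: le_trans (enorm_le_sum _) _.
rewrite mulr_natl -[X in _ *+ X]card_ord -sumr_const; apply: ler_sum => j _.
exact: DMA_coord_le.
Qed.

Lemma DMA_steps_vanish : d k @[k --> \oo] --> 0.
Proof.
apply: (nonmonotone_descent_cvg0 (fun k => F (x k)) _ (c1 / 2) M).
- by rewrite divr_gt0.
- by move=> k; exact: smooth_objective_ge0.
- by move=> k; exact: enorm_ge0.
- exact: DMA_descent.
- move=> e e0.
  have [r r0 Hr] := smooth_objective_modulus f Lf lambda psi phi Omega f_diff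
    Lf_gt0 grad_lip lambda_gt0 HA Cg e Cg_ge0 e0.
  by exists r => // k; exact: Hr.
Qed.

Lemma DMA_etabar_bounded : exists2 H, 0 < H & forall k, etamin <= etabar k <= H.
Proof.
have gm : 0 <= gmax.
  have [/andP[gg gm] _ _ _] := step (Ox 0%N) (vE 0%N).
  exact: le_trans (le_trans (ltW gl_gt0) gg) gm.
have A0 : 0 <= phi B + gmax * Cg.
  by rewrite addr_ge0 ?mulr_ge0//; exact: (A_phi_ge0 HA).
have [K K0 HK] := eta_test_uniform f lambda psi phi Omega lambda_gt0 HA
  B gl etamin _ B_ge0 gl_gt0 etamin_gt0 A0.
exists (Num.max etamax (K / tau)); first by rewrite lt_max divr_gt0 ?orbT.
move=> k; have [/andP[glg ggm] [eta0 /andP[e1 e2] loop] _ _] := step (Ox k) (vE k).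
apply: (eta_loop_bound tau_gt0 tau_lt1 (K := K) etamin_gt0 _ _ loop); last 2 first.
- by rewrite le_max lexx orbT.
- by rewrite e1 le_max e2.
move=> e u ee Ke; rewrite vE; apply: HK => // i.
apply: le_trans (ler_normB _ _) _; apply: lerD; first exact: DMA_coord_le.
by rewrite normrM ger0_norm ?(le_trans (ltW gl_gt0) glg)//; apply: ler_pM;
  rewrite ?(le_trans (ltW gl_gt0) glg).
Qed.

Lemma DMA_cluster_stationary (xs : 'rV[R]_n) : cluster (x @ \oo) xs ->
  psi_opt_stationary f psi phi Omega lambda xs.
Proof.
move=> /cluster_subsequence[s [s_oo sx]].
have [H H0 HH] := DMA_etabar_bounded.
have ds : d (s j) @[j --> \oo] --> 0.
  exact: (cvg_comp _ _ s_oo DMA_steps_vanish).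
have X0 i : x (s j) 0 i @[j --> \oo] --> xs 0 i.
  apply: cvg_le_dist sx => j.
  by have := coord_le_enorm (x (s j) - xs) i; rewrite !mxE.
have X1 i : x (s j).+1 0 i @[j --> \oo] --> xs 0 i.
  apply: (@cvg_le_dist _ _ (fun j => d (s j) + enorm (x (s j) - xs))).
    move=> j; have := coord_le_enorm (x (s j).+1 - x (s j)) i.
    have := coord_le_enorm (x (s j) - xs) i; rewrite !mxE => h1 h2.
    have -> : x (s j).+1 0 i - xs 0 i = (x (s j).+1 0 i - x (s j) 0 i) +
      (x (s j) 0 i - xs 0 i) by ring.
    by apply: le_trans (ler_normD _ _) _; exact: lerD.
  by have -> : (0 : R) = 0 + 0; [rewrite addr0 | exact: cvgD].
have D0 i : grad f (x (s j)) 0 i @[j --> \oo] --> grad f xs 0 i.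
  exact: (cvg_grad f Lf grad_lip).
have V0 i := cvg_psi_norm psi phi Omega HA _ _ (X0 i).
have V1 i := cvg_psi_norm psi phi Omega HA _ _ (X1 i).
have P0 i : rderiv phi (psi `|x (s j) 0 i|) @[j --> \oo] -->
    rderiv phi (psi `|xs 0 i|).
  by apply: (cvg_rderiv_phi _ _ _ HA _ _ _ _ (V0 i)) => [j|];
    exact: (A_psi_ge0 HA).
(* Where both the coordinate and the partial derivative vanish this gives -1, a case in which the
   condition leaves the sign free. *)
pose alpha : 'rV[R]_n := \row_(i < n)
  (if xs 0 i == 0 then - sgn1 (grad f xs 0 i) else sgn1 (xs 0 i)).
have alphaE i : alpha 0 i =
    if xs 0 i == 0 then - sgn1 (grad f xs 0 i) else sgn1 (xs 0 i).
  by rewrite /alpha mxE.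
(* The right derivative of g^i at v_i^k is [rho i k] times that of [phi], because phi(v_i^k) =
   |x_i^k|. *)
pose rho i k := (gamma_ k)^-1 *
  (`|x k 0 i| - `|x k 0 i - gamma_ k * grad f (x k) 0 i|).
have Rho i : rho i (s j) @[j --> \oo] --> alpha 0 i * grad f xs 0 i.
  rewrite alphaE; apply: (@cvg_sign_quotient _ _ (fun j => x (s j).+1 0 i)
    (fun j => grad f (x (s j)) 0 i) (fun j => gamma_ (s j)) _ _ gl) => //.
    by move=> j; have [/andP[]] := step (Ox (s j)) (vE (s j)).
  move=> j; have [_ _ _ xE] := step (Ox (s j)) (vE (s j)).
  have -> : `|x (s j).+1 0 i| = phi (v (s j).+1 0 i).
    by rewrite vE map_psi_absvE (A_psiK HA).
  by rewrite {1}xE [LHS]mxE.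
have xsO : Omega (absv xs).
  apply: (A_Omega_closed HA) => U /nbhs_ballP[e /= e0 eU].
  have /cvgrPdist_lt/(_ e e0)[N _ HN] := sx.
  exists (absv (x (s N))); split; first exact: Ox.
  apply: eU; split => // i j; rewrite ord1 /ball/= !mxE.
  apply: le_lt_trans (ler_dist_dist _ _) _; rewrite distrC.
  have := HN N (leqnn N); rewrite sub0r normrN ger0_norm ?enorm_ge0//.
  apply: le_lt_trans.
  by have := coord_le_enorm (x (s N) - xs) j; rewrite !mxE.
exists H, alpha; split => //.
- move=> i; rewrite alphaE /sgn1.
  by case: ifP => _; case: ifP => _; rewrite ?opprK; [right|left|left|right].
- split => // y yO.
  pose z i := psi `|y 0 i|; pose w i := psi `|xs 0 i|.
  pose a i := lambda + alpha 0 i * grad f xs 0 i * rderiv phi (w i).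
  have lim : \sum_(i < n) (H / 2 * (z i - psi `|x (s j) 0 i|) ^+ 2 +
      (lambda + rho i (s j) * rderiv phi (psi `|x (s j) 0 i|)) *
        (z i - psi `|x (s j).+1 0 i|)) @[j --> \oo] -->
     \sum_(i < n) (H / 2 * (z i - w i) ^+ 2 + a i * (z i - w i)).
    apply: cvg_big => [|i _]; first exact: add_continuous.
    apply: cvgD.
      apply: cvgM; first exact: cvg_cst.
      rewrite expr2; under eq_fun do rewrite expr2.
      by apply: cvgM; apply: cvgB; [exact: cvg_cst|exact: V0|exact: cvg_cst|exact: V0].
    apply: cvgM; last by apply: cvgB; [exact: cvg_cst|exact: V1].
    apply: cvgD; first exact: cvg_cst.
    by apply: cvgM; [exact: Rho | exact: P0].
  (* In the optimality of v^{k+1} against psi(|y|), the quadratic term at v^{k+1} is dropped as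
     nonnegative and the coefficient of the one at y is raised to H; the resulting inequality passes
     to the limit. *)
  have lim0 : 0 <= \sum_(i < n) (H / 2 * (z i - w i) ^+ 2 + a i * (z i - w i)).
    apply: (cvgr_to_ge lim); exists 0%N => // j _ /=; set k := s j.
    have [/andP[glg _] [eta0 _ loop] _ _] := step (Ox k) (vE k).
    have g0 : 0 < gamma_ k := lt_le_trans gl_gt0 glg.
    have [[_ wmin] _] := eta_loop_exit loop.
    have yP : psiOmega (map_mx psi (absv y)) by exists (absv y).
    have := wmin _ yP; rewrite /surrogate !enorm_sqr.
    have /andP[e1 e2] := HH k.
    have S1 : 0 <= etabar k / 2 * \sum_(i < n) (v k.+1 - v k) 0 i ^+ 2.
      apply: mulr_ge0; first by rewrite divr_ge0// (le_trans _ e1)// ltW.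
      by apply: sumr_ge0 => i _; exact: sqr_ge0.
    have S2 : etabar k / 2 * \sum_(i < n) (map_mx psi (absv y) - v k) 0 i ^+ 2 <=
       \sum_(i < n) H / 2 * (z i - psi `|x k 0 i|) ^+ 2.
      rewrite -(mulr_sumr _ _ _ (H / 2)).
      have -> : \sum_(i < n) (map_mx psi (absv y) - v k) 0 i ^+ 2 =
          \sum_(i < n) (z i - psi `|x k 0 i|) ^+ 2.
        by apply: eq_bigr => i _; rewrite vE !mxE.
      rewrite ler_wpM2r ?ler_pM2r// sumr_ge0// => i _; exact: sqr_ge0.
    set S3 := \sum_(i < n) _ * (v k.+1 0 i - _).
    set S4 := \sum_(i < n) _ * (map_mx psi _ 0 i - _).
    have E : \sum_(i < n) (lambda + rho i k * rderiv phi (psi `|x k 0 i|)) *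
        (z i - psi `|x k.+1 0 i|) = S4 - S3.
      rewrite /S4 /S3 -sumrB; apply: eq_bigr => i _.
      rewrite !vE !map_psi_absvE.
      rewrite [rderiv (gfun _ _ _ _ _) _](rderiv_half_sqr _ _ _ HA) ?(A_psi_ge0 HA)//.
      by rewrite (A_psiK HA)// /rho /z; field; rewrite gt_eqF.
    rewrite big_split/= E; lra.
  rewrite subrr; have -> : enorm (0 : 'rV[R]_n) ^+ 2 = 0.
    by rewrite enorm_sqr big1// => i _; rewrite mxE expr0n.
  rewrite enorm_sqr mulr0 add0r.
  have -> : \sum_(i < n) (map_mx psi (absv y) - map_mx psi (absv xs)) 0 i ^+ 2 =
      \sum_(i < n) (z i - w i) ^+ 2.
    by apply: eq_bigr => i _; rewrite !mxE.
  rewrite mulr_sumr -big_split/= -subr_ge0 -sumrB.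
  congr (0 <= _) : lim0; apply: eq_bigr => i _.
  by rewrite /a /z /w; ring.
- by move=> i xi; rewrite alphaE (negbTE xi).
- by move=> i xi _; rewrite alphaE xi eqxx.
Qed.

End Iterates.

Theorem theorem4p1 (R : realType) (n : nat)
    (f : 'rV[R]_n -> R) (Lf lambda : R)
    (psi phi : R -> R) (Omega : set 'rV[R]_n)
    (gmin gmax etamin etamax c1 tau : R) (M : nat)
    (x v : nat -> 'rV[R]_n) (gamma_ etabar : nat -> R) :
  (forall y, 0 <= f y) ->
  (forall y, differentiable f y) ->
  0 < Lf ->
  (forall y z, enorm (grad f y - grad f z) <= Lf * enorm (y - z)) ->
  0 < lambda ->
  assumptionA psi phi Omega ->
  0 < gmin -> gmin <= gmax ->
  0 < etamin -> etamin < etamax ->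
  0 < c1 -> 0 < tau -> tau < 1 ->
  generated_by_DMA f psi phi Omega lambda
    gmin gmax etamin etamax c1 tau M x v gamma_ etabar ->
  [/\ enorm (x k.+1 - x k) @[k --> \oo] --> (0 : R),
      bounded_fun x /\ bounded_fun etabar &
      forall xs : 'rV[R]_n, cluster (x @ \oo) xs ->
        psi_opt_stationary f psi phi Omega lambda xs].
Proof.
move=> f_ge0 f_diff Lf0 grad_lip lambda0 HA gmin0 _ etamin0 _ c10 tau0 tau1 dma.
split.
- exact: (DMA_steps_vanish f_ge0 f_diff Lf0 grad_lip lambda0 HA gmin0 c10
    tau0 tau1 dma).
- split.
    exists (phi (smooth_objective f lambda psi (x 0%N) / lambda)).
    split; first exact: num_real.
    move=> C HC k _ /=; have xk i := DMA_coord_le f_ge0 f_diff Lf0 grad_lip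
      lambda0 HA gmin0 c10 tau0 tau1 dma k i.
    apply: row_norm_le => [|i]; last exact: le_trans (xk i) (ltW HC).
    apply: le_trans (ltW HC); apply: (A_phi_ge0 HA).
    apply: divr_ge0; last exact: ltW.
    exact: smooth_objective_ge0 f_ge0 lambda0 HA _.
  have [H H0 HH] := DMA_etabar_bounded f_ge0 f_diff Lf0 grad_lip lambda0 HA gmin0
    etamin0 c10 tau0 tau1 dma.
  exists H; split; first exact: num_real.
  move=> C HC k _ /=; have /andP[e1 e2] := HH k.
  by rewrite ger0_norm ?(le_trans (ltW etamin0))// (le_trans e2 (ltW HC)).
- exact: (DMA_cluster_stationary f_ge0 f_diff Lf0 grad_lip lambda0 HA gmin0 etamin0
    c10 tau0 tau1 dma).
Qed.
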